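(* Let $k$ be a field, and let $E_1,\dots,E_n$ ($n\ge1$) and $F_1,F_2,\dots,F_m,\dots$ be, respectively, a finite and an infinite sequence of finite (non-empty) quivers. Assume that the number of indices $i$ such that $F_i$ has at least one non-trivial closed path is infinite. Then the $k$-algebras $L(E_1)\otimes\cdots\otimes L(E_n)$ and $\bigotimes_{i=1}^\infty L(F_i)$ are not Morita equivalent.
   Context: All algebras and tensor products are over the field $k$. Morita equivalence of unital $k$-algebras $R,S$ is understood over $k$, i.e. implemented by an $R\otimes S^{op}$-module $P$ and an $S\otimes R^{op}$-module $Q$. For a sequence $S_1,S_2,\dots$ of unital $k$-algebras, $\bigotimes_{j=1}^\infty S_j$ is the colimit of the finite tensor products $S_1\otimes\cdots\otimes S_m$ along the maps $x\mapsto x\otimes1$. A finite quiver $E=(E_0,E_1,r,s)$ has finite sets $E_0$ of vertices and $E_1$ of arrows, and range and source maps $r,s:E_1\to E_0$; non-empty means $E_0\neq\emptyset$. A sink is a vertex that is not the source of any arrow; $\mathrm{Sink}(E)$ is the set of sinks. Paths $\alpha_1\cdots\alpha_l$ satisfy $r(\alpha_i)=s(\alpha_{i+1})$; a non-trivial closed path is a path of length $\ge1$ whose source and range coincide. Leavitt path algebra: let $\hat E$ be the quiver obtained from $E$ by adding, for each $\alpha\in E_1$, an arrow $\alpha^*$ in the opposite direction ($s(\alpha^* )=r(\alpha)$, $r(\alpha^* )=s(\alpha)$). $L(E)$ is the $k$-algebra with generators $p_i$ ($i\in E_0$) and $\alpha\in\hat E_1$, and relations: $p_ip_j=\delta_{i,j}p_i$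 ($i,j\in E_0$); $p_{s(\alpha)}\alpha=\alpha=\alpha p_{r(\alpha)}$ ($\alpha\in\hat E_1$); $\alpha^*\beta=\delta_{\alpha,\beta}p_{r(\alpha)}$ ($\alpha,\beta\in E_1$); $p_i=\sum_{\alpha\in E_1,\,s(\alpha)=i}\alpha\alpha^*$ ($i\in E_0\setminus\mathrm{Sink}(E)$). It is unital with unit $\sum_{i\in E_0}p_i$. *)

(* Defs.v *)
From HB Require Import structures.
From mathcomp Require Import all_boot all_algebra.
From mathcomp Require Import boolp classical_sets.

Set Implicit Arguments.
Unset Strict Implicit.
Unset Printing Implicit Defensive.

Import GRing.Theory.

Local Open Scope ring_scope.
Local Open Scope quotient_scope.

(* Not necessarily unital: there is no expression for a unit. *)
Inductive expr (k X : Type) : Type :=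
  | Gen of X
  | Zero
  | Opp of expr k X
  | Add of expr k X & expr k X
  | Scale of k & expr k X
  | Mul of expr k X & expr k X.

Arguments Gen {k X}.
Arguments Zero {k X}.

HB.instance Definition _ (k X : Type) := gen_eqMixin (expr k X).
HB.instance Definition _ (k X : Type) := gen_choiceMixin (expr k X).

(* The least congruence that contains R and for which the quotient satisfies
   the axioms of associative k-algebras. *)
Inductive pres_eq (k : fieldType) (X : Type)
    (R : expr k X -> expr k X -> Prop) : expr k X -> expr k X -> Prop :=
  | pres_rel x y : R x y -> pres_eq R x y
  | pres_refl x : pres_eq R x x
  | pres_sym x y : pres_eq R x y -> pres_eq R y x
  | pres_trans x y z : pres_eq R x y -> pres_eq R y z -> pres_eq R x z
  | pres_oppE x x' : pres_eq R x x' -> pres_eq R (Opp x) (Opp x')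
  | pres_addE x x' y y' : pres_eq R x x' -> pres_eq R y y' ->
      pres_eq R (Add x y) (Add x' y')
  | pres_scaleE c x x' : pres_eq R x x' -> pres_eq R (Scale c x) (Scale c x')
  | pres_mulE x x' y y' : pres_eq R x x' -> pres_eq R y y' ->
      pres_eq R (Mul x y) (Mul x' y')
  | pres_addA x y z : pres_eq R (Add x (Add y z)) (Add (Add x y) z)
  | pres_addC x y : pres_eq R (Add x y) (Add y x)
  | pres_add0 x : pres_eq R (Add Zero x) x
  | pres_addN x : pres_eq R (Add (Opp x) x) Zero
  | pres_scaleA a b x : pres_eq R (Scale a (Scale b x)) (Scale (a * b) x)
  | pres_scale1 x : pres_eq R (Scale 1 x) x
  | pres_scaleDr a x y :
      pres_eq R (Scale a (Add x y)) (Add (Scale a x) (Scale a y))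
  | pres_scaleDl a b x :
      pres_eq R (Scale (a + b) x) (Add (Scale a x) (Scale b x))
  | pres_mulA x y z : pres_eq R (Mul x (Mul y z)) (Mul (Mul x y) z)
  | pres_mulDl x y z : pres_eq R (Mul (Add x y) z) (Add (Mul x z) (Mul y z))
  | pres_mulDr x y z : pres_eq R (Mul x (Add y z)) (Add (Mul x y) (Mul x z))
  | pres_scaleAl a x y : pres_eq R (Scale a (Mul x y)) (Mul (Scale a x) y)
  | pres_scaleAr a x y : pres_eq R (Scale a (Mul x y)) (Mul x (Scale a y)).

Section Presented.
Variables (k : fieldType) (X : Type) (R : expr k X -> expr k X -> Prop).

Definition pres_eqb : rel (expr k X) := fun x y => `[< pres_eq R x y >].

Lemma pres_eqb_refl : reflexive pres_eqb.
Proof. by move=> x; apply/asboolP; apply: pres_refl. Qed.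

Lemma pres_eqb_sym : symmetric pres_eqb.
Proof. by move=> x y; apply/asboolP/asboolP => /pres_sym. Qed.

Lemma pres_eqb_trans : transitive pres_eqb.
Proof.
move=> y x z /asboolP xy /asboolP yz; apply/asboolP; exact: pres_trans xy yz.
Qed.

Canonical pres_equiv :=
  EquivRel pres_eqb pres_eqb_refl pres_eqb_sym pres_eqb_trans.

Definition presented : Type := {eq_quot pres_equiv}.

HB.instance Definition _ := Choice.on presented.
HB.instance Definition _ := Quotient.on presented.

Lemma presP (x y : expr k X) :
  pres_eq R x y <-> \pi_presented x = \pi_presented y.
Proof.
split=> [xy|/eqP]; first by apply/eqmodP; apply/asboolP.
by rewrite (@eqmodE _ pres_equiv) => /asboolP.
Qed.

Lemma pres_repr (x : expr k X) : pres_eq R (repr (\pi_presented x)) x.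
Proof. by apply/presP; rewrite reprK. Qed.

Definition pres_opp (x : presented) : presented := \pi_presented (Opp (repr x)).
Definition pres_add (x y : presented) : presented :=
  \pi_presented (Add (repr x) (repr y)).
Definition pres_scale (c : k) (x : presented) : presented :=
  \pi_presented (Scale c (repr x)).
Definition pres_mul (x y : presented) : presented :=
  \pi_presented (Mul (repr x) (repr y)).

Lemma pi_opp x : pres_opp (\pi_presented x) = \pi_presented (Opp x).
Proof. by apply/presP; apply/pres_oppE/pres_repr. Qed.

Lemma pi_add x y : pres_add (\pi_presented x) (\pi_presented y)
  = \pi_presented (Add x y).
Proof. by apply/presP; apply/pres_addE; apply/pres_repr. Qed.

Lemma pi_scale c x : pres_scale c (\pi_presented x) = \pi_presented (Scale c x).
Proof. by apply/presP; apply/pres_scaleE/pres_repr. Qed.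

Lemma pi_mul x y : pres_mul (\pi_presented x) (\pi_presented y)
  = \pi_presented (Mul x y).
Proof. by apply/presP; apply/pres_mulE; apply/pres_repr. Qed.

Fact pres_addrA : associative pres_add.
Proof.
elim/quotW=> x; elim/quotW=> y; elim/quotW=> z.
rewrite (pi_add y) (pi_add x) (pi_add x) (pi_add _ z).
by apply/presP; apply: pres_addA.
Qed.

Fact pres_addrC : commutative pres_add.
Proof.
elim/quotW=> x; elim/quotW=> y; rewrite (pi_add x) (pi_add y).
by apply/presP; apply: pres_addC.
Qed.

Fact pres_add0r : left_id (\pi_presented Zero) pres_add.
Proof.
by elim/quotW=> x; rewrite (pi_add _ x); apply/presP; apply: pres_add0.
Qed.

Fact pres_addNr : left_inverse (\pi_presented Zero) pres_opp pres_add.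
Proof.
elim/quotW=> x; rewrite (pi_opp x) (pi_add _ x).
by apply/presP; apply: pres_addN.
Qed.

HB.instance Definition _ := GRing.isZmodule.Build presented
  pres_addrA pres_addrC pres_add0r pres_addNr.

Lemma piD x y : \pi_presented x + \pi_presented y = \pi_presented (Add x y).
Proof. exact: pi_add. Qed.

Fact pres_scalerA a b x : pres_scale a (pres_scale b x) = pres_scale (a * b) x.
Proof.
elim/quotW: x=> x; rewrite (pi_scale b x) (pi_scale a) (pi_scale _ x).
by apply/presP; apply: pres_scaleA.
Qed.

Fact pres_scale1r : left_id 1 pres_scale.
Proof.
by elim/quotW=> x; rewrite (pi_scale 1 x); apply/presP; apply: pres_scale1.
Qed.

Fact pres_scalerDr : right_distributive pres_scale +%R.
Proof.
move=> a; elim/quotW=> x; elim/quotW=> y.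
rewrite piD (pi_scale a x) (pi_scale a y) piD (pi_scale a).
by apply/presP; apply: pres_scaleDr.
Qed.

Fact pres_scalerDl x : {morph pres_scale^~ x : a b / a + b}.
Proof.
elim/quotW: x => x a b.
rewrite (pi_scale a x) (pi_scale b x) piD (pi_scale (a + b)).
by apply/presP; apply: pres_scaleDl.
Qed.

HB.instance Definition _ := GRing.Zmodule_isLmodule.Build k presented
  pres_scalerA pres_scale1r pres_scalerDr pres_scalerDl.

Lemma piZ c x : c *: \pi_presented x = \pi_presented (Scale c x).
Proof. exact: pi_scale. Qed.

Fact pres_mulrA : associative pres_mul.
Proof.
elim/quotW=> x; elim/quotW=> y; elim/quotW=> z.
rewrite (pi_mul y) (pi_mul x) (pi_mul x) (pi_mul _ z).
by apply/presP; apply: pres_mulA.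
Qed.

Fact pres_mulrDl : left_distributive pres_mul +%R.
Proof.
elim/quotW=> x; elim/quotW=> y; elim/quotW=> z.
rewrite piD (pi_mul x) (pi_mul y) (pi_mul _ z) piD.
by apply/presP; apply: pres_mulDl.
Qed.

Fact pres_mulrDr : right_distributive pres_mul +%R.
Proof.
elim/quotW=> x; elim/quotW=> y; elim/quotW=> z.
rewrite piD (pi_mul x y) (pi_mul x z) (pi_mul x) piD.
by apply/presP; apply: pres_mulDr.
Qed.

Fact pres_scalerAl (a : k) (x y : presented) :
  a *: pres_mul x y = pres_mul (a *: x) y.
Proof.
elim/quotW: x => x; elim/quotW: y => y.
rewrite (pi_mul x y) piZ piZ (pi_mul _ y).
by apply/presP; apply: pres_scaleAl.
Qed.

Fact pres_scalerAr (a : k) (x y : presented) :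
  a *: pres_mul x y = pres_mul x (a *: y).
Proof.
elim/quotW: x => x; elim/quotW: y => y.
rewrite (pi_mul x y) piZ piZ (pi_mul x).
by apply/presP; apply: pres_scaleAr.
Qed.

End Presented.

Record quiver := Quiver {
  vertex : finType;
  arrow : finType;
  qsource : arrow -> vertex;
  qrange : arrow -> vertex
}.

Record nequiver := NEQuiver {
  nequiver_quiver :> quiver;
  vertex_neq0 : (0 < #|vertex nequiver_quiver|)%N
}.

Definition sink (E : quiver) (i : vertex E) : bool :=
  [forall a : arrow E, qsource a != i].

(* The path is a :: p, of length (size p).+1. *)
Definition has_closed_path (E : quiver) : Prop :=
  exists (a : arrow E) (p : seq (arrow E)),
    path (fun b c => qrange b == qsource c) a p /\
    qrange (last a p) = qsource a.

(* [inl a] is the arrow a of E, and [inr a] is its reverse. *)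
Definition double_quiver (E : quiver) : quiver := {|
  vertex := vertex E;
  arrow := (arrow E + arrow E)%type;
  qsource := fun a => match a with inl b => qsource b | inr b => qrange b end;
  qrange := fun a => match a with inl b => qrange b | inr b => qsource b end
|}.

Section LeavittRelations.
Variables (k : fieldType) (E : quiver).

Definition leavitt_gen : Type := (vertex E + arrow (double_quiver E))%type.

Definition lv (i : vertex E) : expr k leavitt_gen := Gen (inl i).
Definition la (a : arrow (double_quiver E)) : expr k leavitt_gen :=
  Gen (inr a).

Inductive leavitt_rel : expr k leavitt_gen -> expr k leavitt_gen -> Prop :=
  | leavitt_vertex i j :
      leavitt_rel (Mul (lv i) (lv j)) (if i == j then lv i else Zero)
  | leavitt_source (a : arrow (double_quiver E)) :
      leavitt_rel (Mul (lv (qsource a)) (la a)) (la a)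
  | leavitt_range (a : arrow (double_quiver E)) :
      leavitt_rel (Mul (la a) (lv (qrange a))) (la a)
  | leavitt_CK1 (a b : arrow E) :
      leavitt_rel (Mul (la (inr a)) (la (inl b)))
                  (if a == b then lv (qrange a) else Zero)
  | leavitt_CK2 (i : vertex E) : ~~ sink i ->
      leavitt_rel (lv i)
        (\big[@Add _ _/Zero]_(a : arrow E | qsource a == i)
           Mul (la (inl a)) (la (inr a))).

End LeavittRelations.

(* A representation on functions, which shows that the Leavitt path algebra
   of a non-empty quiver is not zero.  For a vertex j which is not a sink, the
   Euclidean division of n by d := size (outs j) identifies nat with the set
   of pairs of an arrow of source j and a natural number. *)
Section LeavittRepresentation.
Variables (k : fieldType) (E : quiver).

Definition outs (i : vertex E) : seq (arrow E) :=
  enum [pred a | qsource a == i].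

Definition lrep_gen (x : leavitt_gen E) (v : vertex E -> nat -> k) :
    vertex E -> nat -> k :=
  fun j n => match x with
  | inl i => if j == i then v j n else 0
  | inr (inl a) =>
      if (j == qsource a) && (n %% size (outs j) == index a (outs j))%N
      then v (qrange a) (n %/ size (outs j))%N else 0
  | inr (inr a) =>
      if j == qrange a
      then v (qsource a)
             (n * size (outs (qsource a)) + index a (outs (qsource a)))%N
      else 0
  end.

Fixpoint lrep (e : expr k (leavitt_gen E)) (v : vertex E -> nat -> k) :
    vertex E -> nat -> k :=
  match e with
  | Gen x => lrep_gen x v
  | Zero => fun _ _ => 0
  | Opp x => fun j n => - lrep x v j n
  | Add x y => fun j n => lrep x v j n + lrep y v j n
  | Scale c x => fun j n => c * lrep x v j n
  | Mul x y => lrep x (lrep y v)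
  end.

Lemma lrep_ext e v w : (forall j n, v j n = w j n) ->
  forall j n, lrep e v j n = lrep e w j n.
Proof.
elim: e v w => [x|//|x IH|x IHx y IHy|c x IH|x IHx y IHy] v w vw j n /=.
- by case: x => [i|[a|a]] /=; rewrite !vw.
- by rewrite (IH _ w).
- by rewrite (IHx _ w) // (IHy _ w).
- by rewrite (IH _ w).
- by apply: IHx => *; apply: IHy.
Qed.

Lemma lrep_linear e (c : k) v w j n :
  lrep e (fun j n => c * v j n + w j n) j n
  = c * lrep e v j n + lrep e w j n.
Proof.
elim: e v w j n => [x|//|x IH|x IHx y IHy|d x IH|x IHx y IHy] v w j n /=.
- by case: x => [i|[a|a]] /=; case: ifP => _ //; rewrite mulr0 addr0.
- by rewrite mulr0 addr0.
- by rewrite IH mulrN -opprD.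
- by rewrite IHx IHy mulrDr addrACA.
- by rewrite IH mulrDr mulrCA.
- by rewrite -IHx; apply: lrep_ext => *; apply: IHy.
Qed.

Lemma lrep_add e v w j n :
  lrep e (fun j n => v j n + w j n) j n = lrep e v j n + lrep e w j n.
Proof.
rewrite -[lrep e v j n]mul1r -lrep_linear; apply: lrep_ext => *.
by rewrite mul1r.
Qed.

Lemma lrep_zero e j n : lrep e (fun _ _ => 0) j n = 0.
Proof.
set z := fun _ _ => 0.
transitivity (lrep e (fun j n => -1 * z j n + z j n) j n).
  by apply: lrep_ext => *; rewrite mulN1r addNr.
by rewrite lrep_linear mulN1r addNr.
Qed.

Lemma lrep_scale e (c : k) v j n :
  lrep e (fun j n => c * v j n) j n = c * lrep e v j n.
Proof.
rewrite -[RHS]addr0 -[X in _ + X](lrep_zero e j n) -lrep_linear.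
by apply: lrep_ext => *; rewrite addr0.
Qed.

Lemma lrep_big (I : Type) (r : seq I) (P : pred I) F v j n :
  lrep (\big[@Add _ _/Zero]_(i <- r | P i) F i) v j n
  = \sum_(i <- r | P i) lrep (F i) v j n.
Proof.
by elim/big_rec2: _ => [//|i x e _ <-].
Qed.

Lemma mem_outs a : a \in outs (qsource a).
Proof. by rewrite mem_enum inE. Qed.

Lemma lrep_rel e e' : leavitt_rel e e' -> forall v j n,
  lrep e v j n = lrep e' v j n.
Proof.
case=> {e e'} [i j|[a|a]|[a|a]|a b|i] //=.
- move=> v l n; case: (eqVneq i j) => [<-|ij] /=; first by case: (l == i).
  by case: (eqVneq l i) => [->|//]; rewrite (negPf ij).
- by move=> v j n; case: (eqVneq j (qsource a)).
- by move=> v j n; case: (eqVneq j (qrange a)).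
- by move=> v j n; rewrite eqxx.
- by move=> v j n; rewrite eqxx.
- move=> v j n; case: (eqVneq j (qrange a)) => [ja|ja]; last first.
    by case: (a == b) => //=; rewrite (negPf ja).
  case: (eqVneq (qsource a) (qsource b)) => [ab|ab] /=; last first.
    by case: (eqVneq a b) ab => [->|//]; rewrite eqxx.
  have ltab : (index a (outs (qsource a)) < size (outs (qsource a)))%N.
    by rewrite index_mem mem_outs.
  rewrite modnMDl modn_small // divnMDl ?(leq_trans _ ltab) //.
  rewrite divn_small // addn0.
  case: (eqVneq a b) => [<-|nab] /=; first by rewrite eqxx ja eqxx.
  case: ifP => // /eqP eqi; case/eqP: nab.
  rewrite -(nth_index a (mem_outs a)) eqi ab nth_index //; exact: mem_outs.
- rewrite negb_forall => /existsP [a0]; rewrite negbK => /eqP ia0 v j n.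
  rewrite lrep_big /=; case: (eqVneq j i) => [->{j}|ji]; last first.
    rewrite big1 // => a /eqP ->; by rewrite (negPf ji).
  have lt0 : (0 < size (outs i))%N.
    by rewrite -ia0; case: (outs _) (mem_outs a0).
  pose m := (n %% size (outs i))%N.
  have ltm : (m < size (outs i))%N by rewrite ltn_mod.
  pose a := nth a0 (outs i) m.
  have aout : a \in outs i by apply: mem_nth.
  have sa : qsource a == i by move: aout; rewrite mem_enum inE.
  rewrite (bigD1 a) //= (eqP sa) eqxx /=.
  have ia : index a (outs i) = m by rewrite index_uniq // enum_uniq.
  rewrite ia eqxx /= eqxx -divn_eq big1 ?addr0 // => b /andP[/eqP sb ba].
  rewrite sb eqxx /=; case: ifP => // /eqP eqm; case/eqP: ba.
  by rewrite /a /m eqm nth_index // mem_enum inE sb.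
Qed.

Lemma lrep_pres e e' : pres_eq (@leavitt_rel k E) e e' -> forall v j n,
  lrep e v j n = lrep e' v j n.
Proof.
elim=> {e e'} //=.
- exact: lrep_rel.
- by move=> x y z _ xy _ yz v j n; rewrite xy yz.
- by move=> x x' _ IH v j n; rewrite IH.
- by move=> x x' y y' _ IHx _ IHy v j n; rewrite IHx IHy.
- by move=> c x x' _ IH v j n; rewrite IH.
- move=> x x' y y' _ IHx _ IHy v j n; rewrite IHx.
  by apply: lrep_ext => *; apply: IHy.
- by move=> x y z v j n; rewrite addrA.
- by move=> x y v j n; rewrite addrC.
- by move=> x v j n; rewrite add0r.
- by move=> x v j n; rewrite addNr.
- by move=> a b x v j n; rewrite mulrA.
- by move=> x v j n; rewrite mul1r.
- by move=> a x y v j n; rewrite mulrDr.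
- by move=> a b x v j n; rewrite mulrDl.
- by move=> x y z v j n; rewrite lrep_add.
- by move=> a x y v j n; rewrite lrep_scale.
Qed.

End LeavittRepresentation.

Definition leavitt (k : fieldType) (E : nequiver) : Type :=
  presented (@leavitt_rel k E).

Section LeavittAlgebra.
Variables (k : fieldType) (E : nequiver).

Local Notation L := (leavitt k E).

HB.instance Definition _ := GRing.Lmodule.on L.

Definition leavitt_pi (e : expr k (leavitt_gen E)) : L :=
  \pi_(presented (@leavitt_rel k E)) e.

Definition leavitt_p (i : vertex E) : L := leavitt_pi (lv k i).
Definition leavitt_arrow (a : arrow (double_quiver E)) : L :=
  leavitt_pi (la k a).

Definition leavitt_mul : L -> L -> L := @pres_mul _ _ _.

Definition leavitt_one : L := \sum_(i : vertex E) leavitt_p i.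

Lemma leavitt_ind (P : L -> Prop) :
  P 0 -> (forall x, P x -> P (- x)) ->
  (forall x y, P x -> P y -> P (x + y)) ->
  (forall c x, P x -> P (c *: x)) ->
  (forall x y, P x -> P y -> P (leavitt_mul x y)) ->
  (forall i, P (leavitt_p i)) -> (forall a, P (leavitt_arrow a)) ->
  forall x, P x.
Proof.
move=> P0 PN PD PZ PM Pv Pa x.
suff Pe e : P (leavitt_pi e) by rewrite -(reprK x); apply: Pe.
elim: e => [[i|a]||y IH|y IHy z IHz|c y IH|y IHy z IHz] //.
- exact: Pv.
- exact: Pa.
- rewrite (_ : leavitt_pi _ = - leavitt_pi y); first exact: PN.
  by symmetry; apply: pi_opp.
- rewrite (_ : leavitt_pi _ = leavitt_pi y + leavitt_pi z); first exact: PD.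
  by symmetry; apply: piD.
- rewrite (_ : leavitt_pi _ = c *: leavitt_pi y); first exact: PZ.
  by symmetry; apply: piZ.
- rewrite (_ : leavitt_pi _ = leavitt_mul (leavitt_pi y) (leavitt_pi z)).
    exact: PM.
  by symmetry; apply: pi_mul.
Qed.

Lemma leavitt_pi_rel e e' : leavitt_rel e e' -> leavitt_pi e = leavitt_pi e'.
Proof. by move=> ee'; apply/presP; apply: pres_rel. Qed.

Lemma leavitt_pp i j :
  leavitt_mul (leavitt_p i) (leavitt_p j) = if i == j then leavitt_p i else 0.
Proof.
rewrite [LHS]pi_mul [LHS](leavitt_pi_rel (leavitt_vertex k i j)).
by case: ifP.
Qed.

Lemma leavitt_pa (a : arrow (double_quiver E)) :
  leavitt_mul (leavitt_p (qsource a)) (leavitt_arrow a) = leavitt_arrow a.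
Proof. by rewrite [LHS]pi_mul [LHS](leavitt_pi_rel (leavitt_source k a)). Qed.

Lemma leavitt_ap (a : arrow (double_quiver E)) :
  leavitt_mul (leavitt_arrow a) (leavitt_p (qrange a)) = leavitt_arrow a.
Proof. by rewrite [LHS]pi_mul [LHS](leavitt_pi_rel (leavitt_range k a)). Qed.

Fact leavitt_mulA : associative leavitt_mul.
Proof. exact: pres_mulrA. Qed.

Fact leavitt_mulDl : left_distributive leavitt_mul +%R.
Proof. exact: pres_mulrDl. Qed.

Fact leavitt_mulDr : right_distributive leavitt_mul +%R.
Proof. exact: pres_mulrDr. Qed.

Fact leavitt_scaleAl a (x y : L) :
  a *: leavitt_mul x y = leavitt_mul (a *: x) y.
Proof. exact: pres_scalerAl. Qed.

Fact leavitt_scaleAr a (x y : L) :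
  a *: leavitt_mul x y = leavitt_mul x (a *: y).
Proof. exact: pres_scalerAr. Qed.

Fact leavitt_mul0 x : leavitt_mul 0 x = 0.
Proof. by apply: (addrI (leavitt_mul 0 x)); rewrite -leavitt_mulDl !addr0. Qed.

Fact leavitt_mulr0 x : leavitt_mul x 0 = 0.
Proof. by apply: (addrI (leavitt_mul x 0)); rewrite -leavitt_mulDr !addr0. Qed.

Fact leavitt_sum_mul x :
  leavitt_mul leavitt_one x = \sum_i leavitt_mul (leavitt_p i) x.
Proof.
by apply: (big_morph (leavitt_mul^~ x)) => [y z|];
  rewrite (leavitt_mulDl, leavitt_mul0).
Qed.

Fact leavitt_mul_sum x :
  leavitt_mul x leavitt_one = \sum_i leavitt_mul x (leavitt_p i).
Proof.
by apply: (big_morph (leavitt_mul x)) => [y z|];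
  rewrite (leavitt_mulDr, leavitt_mulr0).
Qed.

Fact leavitt_one_p i : leavitt_mul leavitt_one (leavitt_p i) = leavitt_p i.
Proof.
rewrite leavitt_sum_mul (bigD1 i) //= leavitt_pp eqxx big1 ?addr0 // => j ji.
by rewrite leavitt_pp (negPf ji).
Qed.

Fact leavitt_p_one i : leavitt_mul (leavitt_p i) leavitt_one = leavitt_p i.
Proof.
rewrite leavitt_mul_sum (bigD1 i) //= leavitt_pp eqxx big1 ?addr0 // => j ji.
by rewrite leavitt_pp eq_sym (negPf ji).
Qed.

Fact leavitt_mul1 : left_id leavitt_one leavitt_mul.
Proof.
elim/leavitt_ind=> [|x IH|x y IHx IHy|c x IH|x y IHx _|i|a].
- exact: leavitt_mulr0.
- apply/eqP; rewrite -subr_eq0 opprK -{2}IH -leavitt_mulDr addNr.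
  by rewrite leavitt_mulr0.
- by rewrite leavitt_mulDr IHx IHy.
- by rewrite -leavitt_scaleAr IH.
- by rewrite leavitt_mulA IHx.
- exact: leavitt_one_p.
- by rewrite -leavitt_pa leavitt_mulA leavitt_one_p.
Qed.

Fact leavitt_mulr1 : right_id leavitt_one leavitt_mul.
Proof.
elim/leavitt_ind=> [|x IH|x y IHx IHy|c x IH|x y _ IHy|i|a].
- exact: leavitt_mul0.
- apply/eqP; rewrite -subr_eq0 opprK -{2}IH -leavitt_mulDl addNr.
  by rewrite leavitt_mul0.
- by rewrite leavitt_mulDl IHx IHy.
- by rewrite -leavitt_scaleAl IH.
- by rewrite -leavitt_mulA IHy.
- exact: leavitt_p_one.
- by rewrite -leavitt_ap -leavitt_mulA leavitt_p_one.
Qed.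

Fact leavitt_one_neq0 : leavitt_one != 0.
Proof.
apply/eqP => one0; have /card_gt0P[i _] := vertex_neq0 E.
have : leavitt_pi (lv k i) = leavitt_pi Zero.
  by rewrite -[LHS]leavitt_mul1 one0 leavitt_mul0.
move/presP/lrep_pres/(_ (fun _ _ => 1) i 0%N) => /=; rewrite eqxx.
by move/eqP; rewrite oner_eq0.
Qed.

HB.instance Definition _ := GRing.Zmodule_isNzRing.Build L
  leavitt_mulA leavitt_mul1 leavitt_mulr1 leavitt_mulDl leavitt_mulDr
  leavitt_one_neq0.

HB.instance Definition _ := GRing.Lmodule_isLalgebra.Build k L leavitt_scaleAl.
HB.instance Definition _ := GRing.Lalgebra_isAlgebra.Build k L leavitt_scaleAr.

End LeavittAlgebra.

(* A list of pairs (a, b) stands for the formal sum of the a (x) b.  M is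
   acted upon by S on the right through [ract], and N on the left through
   [lact].  The result is an abelian group. *)
Inductive btens_eq (S : Type) (M N : zmodType)
    (ract : M -> S -> M) (lact : S -> N -> N) :
    seq (M * N) -> seq (M * N) -> Prop :=
  | btens_refl s : btens_eq ract lact s s
  | btens_sym s t : btens_eq ract lact s t -> btens_eq ract lact t s
  | btens_trans s t u : btens_eq ract lact s t -> btens_eq ract lact t u ->
      btens_eq ract lact s u
  | btens_cat s s' t t' : btens_eq ract lact s s' -> btens_eq ract lact t t' ->
      btens_eq ract lact (s ++ t) (s' ++ t')
  | btens_catC s t : btens_eq ract lact (s ++ t) (t ++ s)
  | btens_addl a a' b :
      btens_eq ract lact [:: (a + a', b)] [:: (a, b); (a', b)]
  | btens_addr a b b' :
      btens_eq ract lact [:: (a, b + b')] [:: (a, b); (a, b')]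
  | btens_0l b : btens_eq ract lact [:: (0, b)] [::]
  | btens_0r a : btens_eq ract lact [:: (a, 0)] [::]
  | btens_act a c b :
      btens_eq ract lact [:: (ract a c, b)] [:: (a, lact c b)].

Record balanced (S : Type) (M N V : zmodType)
    (ract : M -> S -> M) (lact : S -> N -> N) (h : M -> N -> V) : Prop := {
  balancedDl : forall a a' b, h (a + a') b = h a b + h a' b;
  balancedDr : forall a b b', h a (b + b') = h a b + h a b';
  balanced_act : forall a c b, h (ract a c) b = h a (lact c b)
}.

Section BalancedTensor.
Variables (S : Type) (M N : zmodType).
Variables (ract : M -> S -> M) (lact : S -> N -> N).

Local Notation "s ~~ t" := (btens_eq ract lact s t) (at level 70).

Definition btens_eqb : rel (seq (M * N)) := fun s t => `[< s ~~ t >].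

Lemma btens_eqb_refl : reflexive btens_eqb.
Proof. by move=> s; apply/asboolP; apply: btens_refl. Qed.

Lemma btens_eqb_sym : symmetric btens_eqb.
Proof. by move=> s t; apply/asboolP/asboolP => /btens_sym. Qed.

Lemma btens_eqb_trans : transitive btens_eqb.
Proof.
move=> t s u /asboolP st /asboolP tu; apply/asboolP; exact: btens_trans st tu.
Qed.

Canonical btens_equiv :=
  EquivRel btens_eqb btens_eqb_refl btens_eqb_sym btens_eqb_trans.

Definition btens : Type := {eq_quot btens_equiv}.

HB.instance Definition _ := Choice.on btens.
HB.instance Definition _ := Quotient.on btens.

Lemma btensP s t : s ~~ t <-> \pi_btens s = \pi_btens t.
Proof.
split=> [st|/eqP]; first by apply/eqmodP; apply/asboolP.
by rewrite (@eqmodE _ btens_equiv) => /asboolP.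
Qed.

Lemma btens_repr s : repr (\pi_btens s) ~~ s.
Proof. by apply/btensP; rewrite reprK. Qed.

Definition btens_add (x y : btens) : btens := \pi_btens (repr x ++ repr y).

Definition seq_opp (s : seq (M * N)) := [seq (- p.1, p.2) | p <- s].

Definition btens_opp (x : btens) : btens := \pi_btens (seq_opp (repr x)).

Lemma seq_oppP s : seq_opp s ++ s ~~ [::].
Proof.
elim: s => [|[a b] s IH] /=; first exact: btens_refl.
apply: (@btens_trans _ _ _ _ _ _
  ([:: (- a, b); (a, b)] ++ (seq_opp s ++ s))).
  rewrite -cat1s -[X in _ ~~ X]cat1s; apply: btens_cat; first exact: btens_refl.
  rewrite -cat1s -[(_, _) :: _ ++ _]cat1s !catA.
  by apply: btens_cat; [apply: btens_catC|apply: btens_refl].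
rewrite -[[::]]/([::] ++ [::]); apply: btens_cat IH.
apply: btens_trans (btens_0l ract lact b); rewrite -(addNr a).
exact/btens_sym/btens_addl.
Qed.

Lemma pi_btens_add s t :
  btens_add (\pi_btens s) (\pi_btens t) = \pi_btens (s ++ t).
Proof. by apply/btensP; apply: btens_cat; apply: btens_repr. Qed.

Lemma btens_ex (x : btens) : exists s, x = \pi_btens s.
Proof. by exists (repr x); rewrite reprK. Qed.

Fact btens_addA : associative btens_add.
Proof.
move=> x y z; have [s ->] := btens_ex x; have [t ->] := btens_ex y.
have [u ->] := btens_ex z.
by rewrite (pi_btens_add t) (pi_btens_add s) (pi_btens_add s)
  (pi_btens_add _ u) catA.
Qed.

Fact btens_addC : commutative btens_add.
Proof. by move=> x y; apply/btensP; apply: btens_catC. Qed.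

Fact btens_add0 : left_id (\pi_btens [::]) btens_add.
Proof.
move=> x; have [s ->] := btens_ex x; exact: (pi_btens_add [::] s).
Qed.

Fact btens_addN : left_inverse (\pi_btens [::]) btens_opp btens_add.
Proof.
move=> x; rewrite -{2}(reprK x) /btens_opp (pi_btens_add (seq_opp _)).
by apply/btensP; apply: seq_oppP.
Qed.

HB.instance Definition _ := GRing.isZmodule.Build btens
  btens_addA btens_addC btens_add0 btens_addN.

Definition pure (a : M) (b : N) : btens := \pi_btens [:: (a, b)].

Lemma pureDl a a' b : pure (a + a') b = pure a b + pure a' b.
Proof.
rewrite [RHS](pi_btens_add [:: (a, b)]); apply/btensP; exact: btens_addl.
Qed.

Lemma pureDr a b b' : pure a (b + b') = pure a b + pure a b'.
Proof.
rewrite [RHS](pi_btens_add [:: (a, b)]); apply/btensP; exact: btens_addr.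
Qed.

Lemma pure_act a c b : pure (ract a c) b = pure a (lact c b).
Proof. by apply/btensP; apply: btens_act. Qed.

Lemma pure_balanced : balanced ract lact pure.
Proof. by split; [apply: pureDl|apply: pureDr|apply: pure_act]. Qed.

Lemma btens_ind (P : btens -> Prop) :
  P 0 -> (forall x y, P x -> P y -> P (x + y)) -> (forall a b, P (pure a b)) ->
  forall x, P x.
Proof.
move=> P0 PD Pp x; have [s ->] := btens_ex x.
elim: s => [|[a b] s IH] //.
have -> : \pi_btens ((a, b) :: s) = pure a b + \pi_btens s.
  by symmetry; apply: (pi_btens_add [:: (a, b)]).
exact: PD.
Qed.

Section Lift.
Variables (V : zmodType) (h : M -> N -> V).

Definition btens_lift (x : btens) : V := \sum_(p <- repr x) h p.1 p.2.

Hypothesis hP : balanced ract lact h.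

Lemma balanced0l b : h 0 b = 0.
Proof. by apply: (addrI (h 0 b)); rewrite -(balancedDl hP) !addr0. Qed.

Lemma balanced0r a : h a 0 = 0.
Proof. by apply: (addrI (h a 0)); rewrite -(balancedDr hP) !addr0. Qed.

Lemma btens_sum_eq s t : s ~~ t ->
  \sum_(p <- s) h p.1 p.2 = \sum_(p <- t) h p.1 p.2.
Proof.
elim=> {s t} [//|s t _ -> //|s t u _ -> _ -> //|s s' t t' _ IHs _ IHt|s t
  |a a' b|a b b'|b|a|a c b].
- by rewrite !big_cat /= IHs IHt.
- by rewrite !big_cat /= addrC.
- by rewrite !big_cons big_nil /= !addr0 (balancedDl hP).
- by rewrite !big_cons big_nil /= !addr0 (balancedDr hP).
- by rewrite big_cons big_nil /= addr0 balanced0l.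
- by rewrite big_cons big_nil /= addr0 balanced0r.
- by rewrite !big_cons big_nil /= !addr0 (balanced_act hP).
Qed.

Lemma btens_lift_pi s : btens_lift (\pi_btens s) = \sum_(p <- s) h p.1 p.2.
Proof. exact/btens_sum_eq/btens_repr. Qed.

Lemma btens_lift_pure a b : btens_lift (pure a b) = h a b.
Proof. by rewrite btens_lift_pi big_cons big_nil addr0. Qed.

Lemma btens_liftD x y : btens_lift (x + y) = btens_lift x + btens_lift y.
Proof.
have [s ->] := btens_ex x; have [t ->] := btens_ex y.
by rewrite [_ + _](pi_btens_add s t) !btens_lift_pi big_cat.
Qed.

Lemma btens_lift0 : btens_lift 0 = 0.
Proof. by rewrite btens_lift_pi big_nil. Qed.

End Lift.

Lemma btens_lift_ext (V : zmodType) (h h' : M -> N -> V) x :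
  (forall a b, h a b = h' a b) -> btens_lift h x = btens_lift h' x.
Proof. by move=> hh'; apply: eq_bigr. Qed.

Lemma btens_lift_add (V : zmodType) (h h' : M -> N -> V) x :
  btens_lift (fun a b => h a b + h' a b) x = btens_lift h x + btens_lift h' x.
Proof. exact: big_split. Qed.

End BalancedTensor.

Lemma linear_form_ex (k : fieldType) (V : lmodType k) (v : V) : v != 0 ->
  exists2 f : V -> k, (forall c x y, f (c *: x + y) = c * f x + f y) & f v = 1.
Proof.
move=> v0; pose P (W : set V) :=
  (forall c x y, W x -> W y -> W (c *: x + y)) /\ ~ W v.
have [F FP Ftot|W [[Wlin Wv] Wmax]] := @Zorn_bigcup _ P.
  split=> [c x y [X FX Xx] [Y FY Yy]|[X FX Xv]]; last by case: (FP _ FX).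
  have [XY|YX] := Ftot _ _ FX FY.
    by exists Y => //; apply: (FP _ FY).1 => //; apply: XY.
  by exists X => //; apply: (FP _ FX).1 => //; apply: YX.
have W0 : W 0.
  apply: contrapT => nW0; apply: (Wmax [set 0]%classic).
    have We x : ~ W x.
      by move=> Wx; apply: nW0; rewrite -[0](addNr x) -scaleN1r; apply: Wlin.
    by split=> [x /We //|W0]; apply: (We 0); apply: W0.
  split=> [c x y -> ->|/= ev]; first by rewrite scaler0 addr0.
  by rewrite ev eqxx in v0.
have WZ c x : W x -> W (c *: x).
  by move=> Wx; rewrite -[_ *: _]addr0; apply: Wlin.
have WN x : W x -> W (- x) by rewrite -scaleN1r; apply: WZ.
have WD x y : W x -> W y -> W (x + y).
  by move=> Wx; rewrite -[x]scale1r; apply: Wlin.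
have dec x : exists c, W (x - c *: v).
  apply: contrapT => nx.
  have nWx : ~ W x by move=> Wx; apply: nx; exists 0; rewrite scale0r subr0.
  apply: (Wmax [set y | exists w c, W w /\ y = w + c *: x]%classic).
    split=> [w Ww|sub]; first by exists w, 0; rewrite scale0r addr0.
    by apply/nWx/sub; exists 0, 1; rewrite scale1r add0r.
  split=> [c _ _ [w [a [Ww ->]]] [w' [a' [Ww' ->]]]|[w [c [Ww vE]]]].
    exists (c *: w + w'), (c * a + a'); split; first exact: Wlin.
    by rewrite scalerDr scalerDl scalerA addrACA.
  have [c0|c0] := eqVneq c 0.
    by apply: Wv; rewrite vE c0 scale0r addr0.
  apply: nx; exists c^-1.
  rewrite vE scalerDr scalerA mulVf // scale1r opprD addrC addrNK.
  exact/WN/WZ.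
have uniq_dec x c d : W (x - c *: v) -> W (x - d *: v) -> c = d.
  move=> Wc Wd; apply/eqP; apply: contrapT => /negP cd; apply: Wv.
  rewrite -[v]scale1r -(@mulVf _ (c - d)) ?subr_eq0 // -scalerA; apply: WZ.
  have -> : (c - d) *: v = - (x - c *: v) + (x - d *: v).
    by rewrite opprB addrA subrK scalerBl.
  by apply: WD => //; apply: WN.
pose f x := projT1 (cid (dec x)).
have fP x : W (x - f x *: v) by rewrite /f; case: cid.
exists f => [c x y|].
  apply: (uniq_dec (c *: x + y)) => //.
  have -> : c *: x + y - (c * f x + f y) *: v
      = c *: (x - f x *: v) + (y - f y *: v).
    by rewrite scalerBr scalerA scalerDl opprD addrACA.
  exact: Wlin.
by apply: (uniq_dec v) => //; rewrite scale1r subrr.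
Qed.

Definition tens (k : fieldType) (A B : algType k) : Type :=
  @btens k A B (fun a c => c *: a) (fun c b => c *: b).

Section TensorAlgebra.
Variables (k : fieldType) (A B : algType k).

Local Notation T := (tens A B).

HB.instance Definition _ := GRing.Zmodule.on T.

Definition tpure (a : A) (b : B) : T := pure _ _ a b.

Definition bilinear_map (V : zmodType) (h : A -> B -> V) : Prop :=
  balanced (fun a (c : k) => c *: a) (fun c b => c *: b) h.

Definition tens_lift (V : zmodType) (h : A -> B -> V) (x : T) : V :=
  btens_lift h x.

Lemma tpureDl a a' b : tpure (a + a') b = tpure a b + tpure a' b.
Proof. exact: pureDl. Qed.

Lemma tpureDr a b b' : tpure a (b + b') = tpure a b + tpure a b'.
Proof. exact: pureDr. Qed.

Lemma tpureZ c a b : tpure (c *: a) b = tpure a (c *: b).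
Proof. exact: (@pure_act _ _ _ (fun a c => c *: a) (fun c b => c *: b)). Qed.

Lemma tens_ind (P : T -> Prop) :
  P 0 -> (forall x y, P x -> P y -> P (x + y)) ->
  (forall a b, P (tpure a b)) -> forall x, P x.
Proof. exact: btens_ind. Qed.

Section TensLift.
Variables (V : zmodType) (h : A -> B -> V).
Hypothesis hP : bilinear_map h.

Lemma tens_lift_pure a b : tens_lift h (tpure a b) = h a b.
Proof. exact: btens_lift_pure. Qed.

Lemma tens_liftD x y : tens_lift h (x + y) = tens_lift h x + tens_lift h y.
Proof. exact: btens_liftD. Qed.

Lemma tens_lift0 : tens_lift h 0 = 0.
Proof. exact: btens_lift0. Qed.

End TensLift.

Definition tens_scale (c : k) (x : T) : T :=
  tens_lift (fun a b => tpure (c *: a) b) x.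

Lemma tens_scale_bilin c : bilinear_map (fun a b => tpure (c *: a) b).
Proof.
split=> [a a' b|a b b'|a d b].
- by rewrite scalerDr tpureDl.
- by rewrite tpureDr.
- by rewrite -tpureZ !scalerA mulrC.
Qed.

Lemma tens_scale_pure c a b : tens_scale c (tpure a b) = tpure (c *: a) b.
Proof. exact/tens_lift_pure/tens_scale_bilin. Qed.

Fact tens_scaleDr : right_distributive tens_scale +%R.
Proof. move=> c x y; exact/tens_liftD/tens_scale_bilin. Qed.

Fact tens_scale0 c : tens_scale c 0 = 0.
Proof. exact/tens_lift0/tens_scale_bilin. Qed.

Fact tens_scaleA c d x : tens_scale c (tens_scale d x) = tens_scale (c * d) x.
Proof.
elim/tens_ind: x => [|x y IHx IHy|a b].
- by rewrite !tens_scale0.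
- by rewrite !tens_scaleDr IHx IHy.
- by rewrite !tens_scale_pure scalerA.
Qed.

Fact tens_scale1 : left_id 1 tens_scale.
Proof.
elim/tens_ind=> [|x y IHx IHy|a b].
- exact: tens_scale0.
- by rewrite tens_scaleDr IHx IHy.
- by rewrite tens_scale_pure scale1r.
Qed.

Fact tens_scaleDl x : {morph tens_scale^~ x : c d / c + d}.
Proof.
move=> c d; elim/tens_ind: x => [|x y IHx IHy|a b] /=.
- by rewrite !tens_scale0 addr0.
- by rewrite !tens_scaleDr IHx IHy addrACA.
- by rewrite !tens_scale_pure scalerDl tpureDl.
Qed.

HB.instance Definition _ := GRing.Zmodule_isLmodule.Build k T
  tens_scaleA tens_scale1 tens_scaleDr tens_scaleDl.

Lemma tpureZl c a b : tpure (c *: a) b = c *: tpure a b.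
Proof. by rewrite -tens_scale_pure. Qed.

Lemma tpureZr c a b : tpure a (c *: b) = c *: tpure a b.
Proof. by rewrite -tpureZ tpureZl. Qed.

Definition tens_mul (x y : T) : T :=
  tens_lift (fun a b => tens_lift (fun c d => tpure (a * c) (b * d)) y) x.

Lemma tens_mul_bilinr a b : bilinear_map (fun c d => tpure (a * c) (b * d)).
Proof.
split=> [c c' d|c d d'|c e d].
- by rewrite mulrDr tpureDl.
- by rewrite mulrDr tpureDr.
- by rewrite -!scalerAr tpureZ.
Qed.

Lemma tens_mul_bilinl y :
  bilinear_map (fun a b => tens_lift (fun c d => tpure (a * c) (b * d)) y).
Proof.
split=> [a a' b|a b b'|a e b].
- rewrite -[RHS]btens_lift_add; apply: btens_lift_ext => c d.
  by rewrite mulrDl tpureDl.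
- rewrite -[RHS]btens_lift_add; apply: btens_lift_ext => c d.
  by rewrite mulrDl tpureDr.
- by apply: btens_lift_ext => c d; rewrite -!scalerAl tpureZ.
Qed.

Fact tens_mulDl : left_distributive tens_mul +%R.
Proof. move=> x y z; exact/tens_liftD/tens_mul_bilinl. Qed.

Fact tens_mulDr : right_distributive tens_mul +%R.
Proof.
move=> x y z; rewrite /tens_mul -[RHS]btens_lift_add; apply: btens_lift_ext.
move=> a b; exact/tens_liftD/tens_mul_bilinr.
Qed.

Lemma tens_mul_pure a b c d :
  tens_mul (tpure a b) (tpure c d) = tpure (a * c) (b * d).
Proof.
rewrite /tens_mul tens_lift_pure; last exact: tens_mul_bilinl.
exact/tens_lift_pure/tens_mul_bilinr.
Qed.

Fact tens_mul0l x : tens_mul 0 x = 0.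
Proof. by apply: (addrI (tens_mul 0 x)); rewrite -tens_mulDl !addr0. Qed.

Fact tens_mul0r x : tens_mul x 0 = 0.
Proof. by apply: (addrI (tens_mul x 0)); rewrite -tens_mulDr !addr0. Qed.

Fact tens_mulA : associative tens_mul.
Proof.
move=> x y z.
elim/tens_ind: x => [|x x' IH IH'|a b]; first by rewrite !tens_mul0l.
  by rewrite !tens_mulDl IH IH'.
elim/tens_ind: y => [|y y' IH IH'|c d].
    by rewrite !(tens_mul0l, tens_mul0r).
  by rewrite !(tens_mulDl, tens_mulDr) IH IH'.
elim/tens_ind: z => [|z z' IH IH'|e f]; first by rewrite !tens_mul0r.
  by rewrite !tens_mulDr IH IH'.
by rewrite !tens_mul_pure !mulrA.
Qed.

Fact tens_mul1 : left_id (tpure 1 1) tens_mul.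
Proof.
elim/tens_ind=> [|x y IHx IHy|a b]; first exact: tens_mul0r.
  by rewrite tens_mulDr IHx IHy.
by rewrite tens_mul_pure !mul1r.
Qed.

Fact tens_mulr1 : right_id (tpure 1 1) tens_mul.
Proof.
elim/tens_ind=> [|x y IHx IHy|a b]; first exact: tens_mul0l.
  by rewrite tens_mulDl IHx IHy.
by rewrite tens_mul_pure !mulr1.
Qed.

Fact tens_one_neq0 : tpure 1 1 != 0.
Proof.
have [f flin f1] := linear_form_ex (oner_neq0 A).
have [g glin g1] := linear_form_ex (oner_neq0 B).
have f0 : f 0 = 0.
  by have := flin (-1) 0 0; rewrite scaler0 addr0 mulN1r addNr.
have g0 : g 0 = 0.
  by have := glin (-1) 0 0; rewrite scaler0 addr0 mulN1r addNr.
have hP : bilinear_map (fun a b => f a * g b).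
  split=> [a a' b|a b b'|a c b].
  - by rewrite -[a]scale1r flin mul1r mulrDl scale1r.
  - by rewrite -[b]scale1r glin mul1r mulrDr scale1r.
  - rewrite -[c *: a]addr0 flin f0 addr0 -[c *: b]addr0 glin g0 addr0.
    by rewrite mulrCA mulrA.
apply/eqP => /(congr1 (tens_lift (fun a b => f a * g b))).
rewrite tens_lift_pure // tens_lift0 // f1 g1 mulr1 => /eqP.
by rewrite oner_eq0.
Qed.

HB.instance Definition _ := GRing.Zmodule_isNzRing.Build T
  tens_mulA tens_mul1 tens_mulr1 tens_mulDl tens_mulDr tens_one_neq0.

Fact tens_scaleAl c (x y : T) : c *: (x * y) = (c *: x) * y.
Proof.
elim/tens_ind: x => [|x x' IH IH'|a b].
- by rewrite !(mul0r, scaler0).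
- by rewrite mulrDl !scalerDr mulrDl IH IH'.
elim/tens_ind: y => [|y y' IH IH'|a' b'].
- by rewrite !(mulr0, scaler0).
- by rewrite !mulrDr scalerDr IH IH'.
by rewrite -tpureZl [_ * _]tens_mul_pure [RHS]tens_mul_pure -scalerAl tpureZl.
Qed.

Fact tens_scaleAr c (x y : T) : c *: (x * y) = x * (c *: y).
Proof.
elim/tens_ind: x => [|x x' IH IH'|a b].
- by rewrite !(mul0r, scaler0).
- by rewrite !mulrDl !scalerDr IH IH'.
elim/tens_ind: y => [|y y' IH IH'|a' b'].
- by rewrite !(mulr0, scaler0).
- by rewrite !(mulrDr, scalerDr) IH IH'.
by rewrite -tpureZl [_ * _]tens_mul_pure [RHS]tens_mul_pure -scalerAr tpureZl.
Qed.

HB.instance Definition _ := GRing.Lmodule_isLalgebra.Build k T tens_scaleAl.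
HB.instance Definition _ := GRing.Lalgebra_isAlgebra.Build k T tens_scaleAr.

Lemma tpureM a b c d : tpure a b * tpure c d = tpure (a * c) (b * d).
Proof. exact: tens_mul_pure. Qed.

Definition tens_inl (a : A) : T := tpure a 1.

Fact tens_inl_linear : linear tens_inl.
Proof. by move=> c a a'; rewrite /tens_inl tpureDl tpureZl. Qed.

HB.instance Definition _ := GRing.isLinear.Build k A T _ tens_inl
  tens_inl_linear.

Fact tens_inl_monoid : monoid_morphism tens_inl.
Proof. by split=> // a a'; rewrite /tens_inl tpureM mulr1. Qed.

HB.instance Definition _ := GRing.isMonoidMorphism.Build A T tens_inl
  tens_inl_monoid.

End TensorAlgebra.

Fixpoint fintens (k : fieldType) (n : nat) :
    ('I_n.+1 -> algType k) -> algType k :=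
  match n with
  | 0 => fun A => A ord0
  | m.+1 => fun A =>
      tens (fintens (fun i : 'I_m.+1 => A (widen_ord (leqnSn m.+1) i)))
           (A ord_max)
  end.

Section SeqColimit.
Variables (k : fieldType) (T : nat -> algType k).
Variable f : forall n, {lrmorphism T n -> T n.+1}.

Definition cast_or (m n : nat) (x : T m) (d : T n) : T n :=
  match @eqP _ m n with
  | ReflectT e => ecast i (T i) e x
  | ReflectF _ => d
  end.

(* The transition map from T m to T n, of interest for m <= n only. *)
Fixpoint trans (m n : nat) (x : T m) : T n :=
  match n with
  | 0 => cast_or x 0
  | p.+1 => cast_or x (f p (trans p x))
  end.

Lemma cast_or_id n (x d : T n) : cast_or x d = x.
Proof. by rewrite /cast_or; case: eqP => // e; rewrite eq_axiomK. Qed.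

Lemma cast_or_neq m n (x : T m) (d : T n) : m <> n -> cast_or x d = d.
Proof. by rewrite /cast_or; case: eqP. Qed.

Lemma trans_id n (x : T n) : trans n x = x.
Proof. by case: n x => [|n] x; apply: cast_or_id. Qed.

Lemma transS m n (x : T m) : (m <= n)%N -> trans n.+1 x = f n (trans n x).
Proof.
by move=> mn /=; rewrite cast_or_neq // => e; rewrite e ltnn in mn.
Qed.

Lemma trans_trans m n p (x : T m) : (m <= n)%N -> (n <= p)%N ->
  trans p (trans n x) = trans p x.
Proof.
move=> mn; elim: p => [|p IH].
  by rewrite leqn0 => /eqP n0; subst n; rewrite trans_id.
rewrite leq_eqVlt ltnS => /orP[/eqP np|np]; first by subst n; rewrite trans_id.
by rewrite !transS ?IH // (leq_trans mn).
Qed.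

Lemma trans_linear m n : (m <= n)%N -> linear (@trans m n).
Proof.
elim: n => [|n IH] mn c x y.
  by move: mn; rewrite leqn0 => /eqP m0; subst m; rewrite !trans_id.
move: mn; rewrite leq_eqVlt ltnS => /orP[/eqP np|np].
  by subst m; rewrite !trans_id.
by rewrite !transS // IH // linearP.
Qed.

Lemma trans_monoid m n : (m <= n)%N -> monoid_morphism (@trans m n).
Proof.
elim: n => [|n IH] mn.
  by move: mn; rewrite leqn0 => /eqP m0; subst m; split=> [|x y];
    rewrite !trans_id.
move: mn; rewrite leq_eqVlt ltnS => /orP[/eqP np|np].
  by subst m; split=> [|x y]; rewrite !trans_id.
have [IH1 IHM] := IH np.
by split=> [|x y]; rewrite !transS // ?IH1 ?IHM ?rmorph1 ?rmorphM.
Qed.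

Definition stage : Type := {n : nat & T n}.

HB.instance Definition _ := gen_eqMixin stage.
HB.instance Definition _ := gen_choiceMixin stage.

Definition colim_eq (x y : stage) : Prop := exists N,
  [/\ (projT1 x <= N)%N, (projT1 y <= N)%N
    & trans N (projT2 x) = trans N (projT2 y)].

Definition colim_eqb : rel stage := fun x y => `[< colim_eq x y >].

Lemma colim_eqb_refl : reflexive colim_eqb.
Proof. by move=> x; apply/asboolP; exists (projT1 x). Qed.

Lemma colim_eqb_sym : symmetric colim_eqb.
Proof. by move=> x y; apply/asboolP/asboolP => -[N [? ? ?]]; exists N. Qed.

Lemma colim_eqb_trans : transitive colim_eqb.
Proof.
move=> y x z /asboolP[N [xN yN xy]] /asboolP[P [yP zP yz]].
apply/asboolP; exists (maxn N P); split.
- by rewrite leq_max xN.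
- by rewrite leq_max zP orbT.
rewrite -(trans_trans _ xN) ?leq_maxl // xy (trans_trans _ yN) ?leq_maxl //.
by rewrite -(trans_trans _ yP) ?leq_maxr // yz (trans_trans _ zP) ?leq_maxr.
Qed.

Canonical colim_equiv :=
  EquivRel colim_eqb colim_eqb_refl colim_eqb_sym colim_eqb_trans.

Definition seqcolim : Type := {eq_quot colim_equiv}.

HB.instance Definition _ := Choice.on seqcolim.
HB.instance Definition _ := Quotient.on seqcolim.

Definition incolim (n : nat) (x : T n) : seqcolim :=
  \pi_seqcolim (existT (fun i => T i : Type) n x).

Lemma incolim_eq m n (x : T m) (y : T n) : incolim x = incolim y <->
  exists N, [/\ (m <= N)%N, (n <= N)%N & trans N x = trans N y].
Proof.
split=> [/eqP|xy]; last by apply/eqmodP; apply/asboolP.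
by rewrite (@eqmodE _ colim_equiv) => /asboolP.
Qed.

Lemma incolim_trans m n (x : T m) : (m <= n)%N -> incolim (trans n x)
  = incolim x.
Proof. by move=> mn; apply/incolim_eq; exists n; rewrite trans_id. Qed.

Lemma incolim_f n (x : T n) : incolim (f n x) = incolim x.
Proof.
by rewrite -[RHS](@incolim_trans _ n.+1) ?leqnSn // transS // trans_id.
Qed.

Lemma incolim_ex (x : seqcolim) : exists n (y : T n), x = incolim y.
Proof.
rewrite -(reprK x); case: (repr x) => n y; by exists n, y.
Qed.

Lemma incolim_ex_ge (x : seqcolim) :
  exists N, forall n, (N <= n)%N -> exists y : T n, x = incolim y.
Proof.
have [m [y ->]] := incolim_ex x; exists m => n mn.
by exists (trans n y); rewrite incolim_trans.
Qed.

Lemma incolim_ex3 (x y z : seqcolim) : exists n (a b c : T n),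
  [/\ x = incolim a, y = incolim b & z = incolim c].
Proof.
have [m xm] := incolim_ex_ge x; have [n yn] := incolim_ex_ge y.
have [p zp] := incolim_ex_ge z; pose N := maxn m (maxn n p).
have [|a ->] := xm N; first by rewrite leq_max leqnn.
have [|b ->] := yn N; first by rewrite !leq_max leqnn orbT.
have [|c ->] := zp N; first by rewrite !leq_max leqnn !orbT.
by exists N, a, b, c.
Qed.

Definition colim_op2 (op : forall n, T n -> T n -> T n) (x y : seqcolim) :
    seqcolim :=
  let N := (projT1 (repr x) + projT1 (repr y))%N in
  incolim (op N (trans N (projT2 (repr x))) (trans N (projT2 (repr y)))).

Definition colim_op1 (op : forall n, T n -> T n) (x : seqcolim) : seqcolim :=
  incolim (op _ (projT2 (repr x))).

Lemma repr_incolim n (x : T n) : exists N,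
  [/\ (projT1 (repr (incolim x)) <= N)%N, (n <= N)%N
    & trans N (projT2 (repr (incolim x))) = trans N x].
Proof.
apply/incolim_eq; rewrite -[RHS]reprK; by case: (repr (incolim x)).
Qed.

Lemma colim_op1E (op : forall n, T n -> T n) :
  (forall m n x, (m <= n)%N -> @trans m n (op m x) = op n (trans n x)) ->
  forall n (x : T n), colim_op1 op (incolim x) = incolim (op n x).
Proof.
move=> opP n x; have [N [xN nN e]] := repr_incolim x.
by apply/incolim_eq; exists N; split=> //; rewrite !opP // e.
Qed.

Lemma colim_op2E (op : forall n, T n -> T n -> T n) :
  (forall m n x y, (m <= n)%N ->
     @trans m n (op m x y) = op n (trans n x) (trans n y)) ->
  forall n (x y : T n), colim_op2 op (incolim x) (incolim y)
    = incolim (op n x y).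
Proof.
move=> opP n x y; have [N [xN nN e]] := repr_incolim x.
have [N' [yN nN' e']] := repr_incolim y; rewrite /colim_op2.
set p := projT1 (repr (incolim x)) in xN *.
set q := projT1 (repr (incolim y)) in yN *.
apply/incolim_eq; exists (N + N')%N.
have NN : (N <= N + N')%N by apply: leq_addr.
have NN' : (N' <= N + N')%N by apply: leq_addl.
have pq : (p + q <= N + N')%N by apply: leq_add.
split=> //; first exact: leq_trans NN.
rewrite !opP ?(leq_trans nN) // !trans_trans ?leq_addr ?leq_addl //.
congr (op _ _ _).
  by rewrite -(trans_trans _ xN) // e trans_trans.
by rewrite -(trans_trans _ yN) // e' trans_trans.
Qed.

Lemma transD m n (x y : T m) : (m <= n)%N ->
  trans n (x + y) = trans n x + trans n y.
Proof. by move=> /trans_linear lin; rewrite -[x]scale1r lin !scale1r. Qed.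

Lemma trans0 m n : (m <= n)%N -> trans n (0 : T m) = 0.
Proof.
move=> mn; apply: (addrI (trans n (0 : T m))).
by rewrite -transD // !addr0.
Qed.

Lemma transZ c m n (x : T m) : (m <= n)%N -> trans n (c *: x) = c *: trans n x.
Proof.
move=> mn; rewrite -[c *: x in LHS]addr0 (trans_linear mn) trans0 //.
by rewrite addr0.
Qed.

Lemma transN m n (x : T m) : (m <= n)%N -> trans n (- x) = - trans n x.
Proof. by move=> mn; rewrite -scaleN1r transZ // scaleN1r. Qed.

Lemma transM m n (x y : T m) : (m <= n)%N ->
  trans n (x * y) = trans n x * trans n y.
Proof. by move=> /trans_monoid[]. Qed.

Definition colim_add := colim_op2 (fun n x y => x + y).
Definition colim_mul := colim_op2 (fun n x y => x * y).
Definition colim_opp := colim_op1 (fun n x => - x).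
Definition colim_scale (c : k) := colim_op1 (fun n x => c *: x).

Lemma colim_addE n (x y : T n) :
  colim_add (incolim x) (incolim y) = incolim (x + y).
Proof. by apply: colim_op2E => *; apply: transD. Qed.

Lemma colim_mulE n (x y : T n) :
  colim_mul (incolim x) (incolim y) = incolim (x * y).
Proof. by apply: colim_op2E => *; apply: transM. Qed.

Lemma colim_oppE n (x : T n) : colim_opp (incolim x) = incolim (- x).
Proof. by apply: colim_op1E => *; apply: transN. Qed.

Lemma colim_scaleE c n (x : T n) :
  colim_scale c (incolim x) = incolim (c *: x).
Proof. by apply: colim_op1E => *; apply: transZ. Qed.

Definition colim_zero : seqcolim := incolim (0 : T 0).
Definition colim_one : seqcolim := incolim (1 : T 0).

Lemma colim_zeroE n : colim_zero = incolim (0 : T n).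
Proof. by rewrite -[LHS](@incolim_trans 0 n) // trans0. Qed.

Lemma colim_oneE n : colim_one = incolim (1 : T n).
Proof. by rewrite -[LHS](@incolim_trans 0 n) // (trans_monoid (leq0n n)).1. Qed.

Fact colim_addA : associative colim_add.
Proof.
move=> x y z; have [n [a [b [c [-> -> ->]]]]] := incolim_ex3 x y z.
by rewrite !colim_addE addrA.
Qed.

Fact colim_addC : commutative colim_add.
Proof.
move=> x y; have [n [a [b [c [-> -> _]]]]] := incolim_ex3 x y x.
by rewrite !colim_addE addrC.
Qed.

Fact colim_add0 : left_id colim_zero colim_add.
Proof.
by move=> x; have [n [a ->]] := incolim_ex x;
  rewrite (colim_zeroE n) colim_addE add0r.
Qed.

Fact colim_addN : left_inverse colim_zero colim_opp colim_add.
Proof.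
by move=> x; have [n [a ->]] := incolim_ex x;
  rewrite colim_oppE colim_addE addNr (colim_zeroE n).
Qed.

HB.instance Definition _ := GRing.isZmodule.Build seqcolim
  colim_addA colim_addC colim_add0 colim_addN.

Lemma incolimD n (x y : T n) : incolim (x + y) = incolim x + incolim y.
Proof. by symmetry; apply: colim_addE. Qed.

Fact colim_mulA : associative colim_mul.
Proof.
move=> x y z; have [n [a [b [c [-> -> ->]]]]] := incolim_ex3 x y z.
by rewrite !colim_mulE mulrA.
Qed.

Fact colim_mul1 : left_id colim_one colim_mul.
Proof.
by move=> x; have [n [a ->]] := incolim_ex x;
  rewrite (colim_oneE n) colim_mulE mul1r.
Qed.

Fact colim_mulr1 : right_id colim_one colim_mul.
Proof.
by move=> x; have [n [a ->]] := incolim_ex x;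
  rewrite (colim_oneE n) colim_mulE mulr1.
Qed.

Fact colim_mulDl : left_distributive colim_mul +%R.
Proof.
move=> x y z; have [n [a [b [c [-> -> ->]]]]] := incolim_ex3 x y z.
by rewrite -incolimD !colim_mulE -incolimD mulrDl.
Qed.

Fact colim_mulDr : right_distributive colim_mul +%R.
Proof.
move=> x y z; have [n [a [b [c [-> -> ->]]]]] := incolim_ex3 x y z.
by rewrite -incolimD !colim_mulE -incolimD mulrDr.
Qed.

Fact colim_one_neq0 : colim_one != 0.
Proof.
apply/eqP => /incolim_eq[N [_ _]].
rewrite (trans_monoid (leq0n N)).1 trans0 // => /eqP; by rewrite oner_eq0.
Qed.

HB.instance Definition _ := GRing.Zmodule_isNzRing.Build seqcolim
  colim_mulA colim_mul1 colim_mulr1 colim_mulDl colim_mulDr colim_one_neq0.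

Lemma incolimM n (x y : T n) : incolim (x * y) = incolim x * incolim y.
Proof. by symmetry; apply: colim_mulE. Qed.

Fact colim_scaleA c d x :
  colim_scale c (colim_scale d x) = colim_scale (c * d) x.
Proof.
by have [n [a ->]] := incolim_ex x; rewrite !colim_scaleE scalerA.
Qed.

Fact colim_scale1 : left_id 1 colim_scale.
Proof.
by move=> x; have [n [a ->]] := incolim_ex x; rewrite !colim_scaleE scale1r.
Qed.

Fact colim_scaleDr : right_distributive colim_scale +%R.
Proof.
move=> c x y; have [n [a [b [_ [-> -> _]]]]] := incolim_ex3 x y x.
by rewrite -incolimD !colim_scaleE -incolimD scalerDr.
Qed.

Fact colim_scaleDl x : {morph colim_scale^~ x : c d / c + d}.
Proof.
move=> c d; have [n [a ->]] := incolim_ex x.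
by rewrite !colim_scaleE -incolimD scalerDl.
Qed.

HB.instance Definition _ := GRing.Zmodule_isLmodule.Build k seqcolim
  colim_scaleA colim_scale1 colim_scaleDr colim_scaleDl.

Lemma incolimZ c n (x : T n) : incolim (c *: x) = c *: incolim x.
Proof. by symmetry; apply: colim_scaleE. Qed.

Fact colim_scaleAl c (x y : seqcolim) : c *: (x * y) = (c *: x) * y.
Proof.
have [n [a [b [_ [-> -> _]]]]] := incolim_ex3 x y x.
by rewrite -incolimM -!incolimZ -incolimM scalerAl.
Qed.

Fact colim_scaleAr c (x y : seqcolim) : c *: (x * y) = x * (c *: y).
Proof.
have [n [a [b [_ [-> -> _]]]]] := incolim_ex3 x y x.
by rewrite -incolimM -!incolimZ -incolimM scalerAr.
Qed.

HB.instance Definition _ :=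
  GRing.Lmodule_isLalgebra.Build k seqcolim colim_scaleAl.
HB.instance Definition _ :=
  GRing.Lalgebra_isAlgebra.Build k seqcolim colim_scaleAr.

End SeqColimit.

Definition inftens_stage (k : fieldType) (A : nat -> algType k) (n : nat) :
    algType k :=
  fintens (fun i : 'I_n.+1 => A i).

(* [inftens_stage A n.+1] is convertible to
   [tens (inftens_stage A n) (A n.+1)]. *)
Definition inftens_map (k : fieldType) (A : nat -> algType k) (n : nat) :
    {lrmorphism inftens_stage A n -> inftens_stage A n.+1} :=
  @tens_inl k (inftens_stage A n) (A n.+1).

Definition inftens (k : fieldType) (A : nat -> algType k) : algType k :=
  seqcolim (inftens_map A).

Section ConverseAlgebra.
Variables (k : fieldType) (A : algType k).

Definition conv_scale (c : k) (x : A^c) : A^c := c *: (x : A).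

Fact conv_scaleA a b x : conv_scale a (conv_scale b x) = conv_scale (a * b) x.
Proof. exact: (@scalerA k A). Qed.

Fact conv_scale1 : left_id 1 conv_scale.
Proof. exact: (@scale1r k A). Qed.

Fact conv_scaleDr : right_distributive conv_scale +%R.
Proof. exact: (@scalerDr k A). Qed.

Fact conv_scaleDl x : {morph conv_scale^~ x : a b / a + b}.
Proof. by move=> a b; apply: (@scalerDl k A). Qed.

HB.instance Definition _ := GRing.Zmodule_isLmodule.Build k A^c
  conv_scaleA conv_scale1 conv_scaleDr conv_scaleDl.

Fact conv_scaleAl c (x y : A^c) : c *: (x * y) = (c *: x) * y.
Proof. exact: (@scalerAr k A). Qed.

Fact conv_scaleAr c (x y : A^c) : c *: (x * y) = x * (c *: y).
Proof. exact: (@scalerAl k A). Qed.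

HB.instance Definition _ := GRing.Lmodule_isLalgebra.Build k A^c conv_scaleAl.
HB.instance Definition _ := GRing.Lalgebra_isAlgebra.Build k A^c conv_scaleAr.

End ConverseAlgebra.

(* A module P over R (x) S^op is an R-S-bimodule with r p s = (r (x) s) p. *)
Section Bimodules.
Variables (k : fieldType) (R S : algType k).

Definition lmul (P : lmodType (tens R S^c)) (r : R) (p : P) : P :=
  tpure r (1 : S^c) *: p.

Definition rmul (P : lmodType (tens R S^c)) (p : P) (s : S) : P :=
  tpure (1 : R) (s : S^c) *: p.

End Bimodules.

Section BimoduleTensor.
Variables (k : fieldType) (R S : algType k).
Variables (P : lmodType (tens R S^c)) (Q : lmodType (tens S R^c)).

Definition bimod_tens : Type := btens (@rmul k R S P) (@lmul k S R Q).

HB.instance Definition _ := GRing.Zmodule.on bimod_tens.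

Definition bimod_pure (p : P) (q : Q) : bimod_tens := pure _ _ p q.

(* There is an isomorphism of R-R-bimodules from P (x)_S Q to R.  The two
   actions on P (x)_S Q are determined by r (p (x) q) r' = (r p) (x) (q r'). *)
Definition bimod_tens_iso : Prop :=
  exists phi : bimod_tens -> R,
    [/\ bijective phi,
        (forall x y, phi (x + y) = phi x + phi y)
      & forall (r r' : R) (p : P) (q : Q),
          phi (bimod_pure (lmul r p) (rmul q r'))
          = r * phi (bimod_pure p q) * r'].

End BimoduleTensor.

Definition morita_equivalent (k : fieldType) (R S : algType k) : Prop :=
  exists (P : lmodType (tens R S^c)) (Q : lmodType (tens S R^c)),
    bimod_tens_iso P Q /\ bimod_tens_iso Q P.

(* Main.v *)
From HB Require Import structures.
Require Import Defs.
From mathcomp Require Import all_boot all_algebra.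
From mathcomp Require Import zify.
From mathcomp Require Import boolp classical_sets functions cardinality.

(** Call A the finite tensor product and S the infinite one.  The two algebras
    are distinguished by their homological dimension: A has dimension at most
    the number of its factors, while S has Koszul complexes of every length
    which do not split.

    Each Leavitt path algebra L is quasi-free.  A derivation of L which
    vanishes on the vertices can take arbitrary values on the arrows, up to
    compatibility with sources and ranges [leavitt_derivation], so derivations lift along surjections of bimodules,
    and second Hochschild cohomology vanishes.  In terms of modules: if a
    complex of projective modules has a contraction in two consecutive degrees
    which is linear over B, then it has one in the upper degree which is linear
    over B (x) L [contraction_step].  Starting from contractions over the
    ground field, a tensor product of n.+1 Leavitt path algebras is reached
    after the loss of n.+1 degrees [leavitt_tensor_contraction].

    Suppose that P is an invertible bimodule between A and S.  Commuting
    elements s_0, s_1, ... of S act on P by A-linear maps; the Koszul complex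
    of these maps consists of projective A-modules.  If the s_i form a regular
    sequence in a sense witnessed by linear operators R_i, the complex has
    contractions over the field, so that with n.+3 elements its top
    differential P -> P^(n.+3) has an A-linear retraction
    [leavitt_tensor_koszul_splits].  The endomorphisms of P over A
    come from S, and the retraction becomes an identity
    \sum_i s_i * c_i = 1 in S [morita_koszul_splits].

    In S this identity can be made impossible.  If c is a closed path of F_t,
    then 1 - c is regular on the right: this follows from the grading of L(F_t)
    by path length [path_regular].  On the other hand, a linear form which is 1
    at 1 vanishes on (1 - c) L(F_t): let L(F_t) act on functions on infinite
    paths and evaluate at the periodic path c c c ...
    [closed_path_functional].  Since infinitely many F_t have closed paths,
    S contains such elements in n.+3 distinct tensor factors; they commute, and
    the tensor product of the linear forms vanishes on the right ideal which
    they generate, although it is 1 at 1. *)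

Set Implicit Arguments.
Unset Strict Implicit.
Unset Printing Implicit Defensive.

Import GRing.Theory.

Local Open Scope ring_scope.

(** * Linear maps *)

Section LinearFunctions.
Variables (k : fieldType) (U V : lmodType k) (f : U -> V).
Hypothesis flin : linear f.

Lemma lin_pack : exists F : {linear U -> V}, f = F.
Proof.
by exists (HB.pack_for {linear U -> V} f (GRing.isLinear.Build k U V _ f flin)).
Qed.

Lemma lin0 : f 0 = 0.
Proof. by have [F ->] := lin_pack; rewrite linear0. Qed.

Lemma linD x y : f (x + y) = f x + f y.
Proof. by have [F ->] := lin_pack; rewrite linearD. Qed.

Lemma linN x : f (- x) = - f x.
Proof. by have [F ->] := lin_pack; rewrite linearN. Qed.

Lemma linB x y : f (x - y) = f x - f y.
Proof. by have [F ->] := lin_pack; rewrite linearB. Qed.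

Lemma linZ c x : f (c *: x) = c *: f x.
Proof. by have [F ->] := lin_pack; rewrite linearZ. Qed.

Lemma lin_sum I (r : seq I) (P : pred I) (F : I -> U) :
  f (\sum_(i <- r | P i) F i) = \sum_(i <- r | P i) f (F i).
Proof. by have [G ->] := lin_pack; rewrite linear_sum. Qed.

End LinearFunctions.

(** Zorn's lemma gives a maximal subspace W which meets the image of f only in
    0; maximality makes it a complement of the image, and g is the projection
    along W followed by the inverse of f. *)
Lemma linear_retraction (k : fieldType) (U V : lmodType k) (f : U -> V) :
  linear f -> (forall u, f u = 0 -> u = 0) ->
  exists2 g : V -> U, linear g & forall u, g (f u) = u.
Proof.
move=> flin finj; pose P (W : set V) :=
  (forall c x y, W x -> W y -> W (c *: x + y)) /\ (forall u, W (f u) -> u = 0).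
have [F FP Ftot|W [[Wlin Wf] Wmax]] := @Zorn_bigcup _ P.
  split=> [c x y [X FX Xx] [Y FY Yy]|u [X FX Xu]]; last exact: (FP _ FX).2.
  have [XY|YX] := Ftot _ _ FX FY.
    by exists Y => //; apply: (FP _ FY).1 => //; apply: XY.
  by exists X => //; apply: (FP _ FX).1 => //; apply: YX.
have WZ c x : W x -> W (c *: x).
  move=> Wx; have -> : c *: x = (c - 1) *: x + x.
    by rewrite scalerBl scale1r subrK.
  exact: Wlin.
have W0 : W 0.
  apply: contrapT => nW0; apply: (Wmax [set 0]%classic).
    have We x : ~ W x by move=> Wx; apply: nW0; rewrite -(scale0r x); apply: WZ.
    by split=> [x /We //|W0]; apply: (We 0); apply: W0.
  split=> [c x y -> ->|u /= fu]; first by rewrite scaler0 addr0.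
  exact: finj.
have dec x : exists u, W (x - f u).
  apply: contrapT => nx.
  apply: (Wmax [set y | exists w c, W w /\ y = w + c *: x]%classic).
    split=> [w Ww|sub]; first by exists w, 0; rewrite scale0r addr0.
    apply: nx; exists 0; rewrite (lin0 flin) subr0; apply: sub.
    by exists 0, 1; rewrite scale1r add0r.
  split=> [c _ _ [w [a [Ww ->]]] [w' [a' [Ww' ->]]]|u [w [c [Ww uE]]]].
    exists (c *: w + w'), (c * a + a'); split; first exact: Wlin.
    by rewrite scalerDr scalerDl scalerA addrACA.
  have [c0|c0] := eqVneq c 0.
    by apply: Wf; rewrite uE c0 scale0r addr0.
  case: nx; exists (c^-1 *: u).
  rewrite (linZ flin) uE scalerDr scalerA mulVf // scale1r opprD addrC addrNK.
  by rewrite -scaleNr; apply: WZ.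
have uniq_dec x u u' : W (x - f u) -> W (x - f u') -> u = u'.
  move=> Wu Wu'; apply/eqP; rewrite -subr_eq0; apply/eqP/Wf.
  have -> : f (u - u') = (-1) *: (x - f u) + (x - f u').
    by rewrite scaleN1r opprB addrA subrK (linB flin).
  exact: Wlin.
have [g gP] := choice dec.
exists g => [c x y|u]; last first.
  by apply: (uniq_dec (f u)) => //; rewrite subrr.
apply: (uniq_dec (c *: x + y)) => //.
have -> : c *: x + y - f (c *: g x + g y) = c *: (x - f (g x)) + (y - f (g y)).
  by rewrite flin scalerBr opprD addrACA.
exact: Wlin.
Qed.

(** * Modules as vector spaces with an action *)

Definition bilin (k : fieldType) (U V W : lmodType k) (H : U -> V -> W) :=
  (forall v, linear (H^~ v)) /\ (forall u, linear (H u)).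

(** The algebra is not built into the type of the vectors, because the same
    space is studied under several algebras at once: an action is restricted to
    the tensor factors of A one after the other, and maps which are linear over
    some of the factors only have to be compared. *)
Record amod (k : fieldType) (A : algType k) := AMod {
  amod_sort :> lmodType k;
  act : A -> amod_sort -> amod_sort;
  act_bilin : bilin act;
  actM : forall a b x, act (a * b) x = act a (act b x);
  act1 : forall x, act 1 x = x
}.

Section ActTheory.
Variables (k : fieldType) (A : algType k) (X : amod A).

Lemma act_linl (x : X) : linear (fun a => act a x).
Proof. exact: (act_bilin X).1. Qed.

Lemma act_linr (a : A) : linear (@act _ _ X a).
Proof. exact: (act_bilin X).2. Qed.

End ActTheory.

(** * Actions of Leavitt path algebras *)

Section PresentedAction.
Variables (k : fieldType) (G : Type) (R : expr k G -> expr k G -> Prop).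
Variables (V : lmodType k) (g : G -> V -> V).
Hypothesis glin : forall x, linear (g x).

Fixpoint expr_act (e : expr k G) : V -> V :=
  match e with
  | Gen x => g x
  | Zero => fun _ => 0
  | Opp x => fun v => - expr_act x v
  | Add x y => fun v => expr_act x v + expr_act y v
  | Scale c x => fun v => c *: expr_act x v
  | Mul x y => fun v => expr_act x (expr_act y v)
  end.

Lemma expr_act_linear e : linear (expr_act e).
Proof.
elim: e => [x||x IH|x IHx y IHy|d x IH|x IHx y IHy] c v w /=.
- exact: glin.
- by rewrite scaler0 addr0.
- by rewrite IH opprD scalerN.
- by rewrite IHx IHy scalerDr addrACA.
- by rewrite IH scalerDr !scalerA mulrC.
- by rewrite IHy IHx.
Qed.

Hypothesis gR : forall e e', R e e' -> expr_act e =1 expr_act e'.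

(** Only the defining relations have to be checked: the other clauses of
    [pres_eq] are identities between linear operators. *)
Lemma expr_act_pres e e' : pres_eq R e e' -> expr_act e =1 expr_act e'.
Proof.
elim=> {e e'} //=.
- by move=> x y _ xy v; rewrite xy.
- by move=> x y z _ xy _ yz v; rewrite xy yz.
- by move=> x x' _ IH v; rewrite IH.
- by move=> x x' y y' _ IHx _ IHy v; rewrite IHx IHy.
- by move=> c x x' _ IH v; rewrite IH.
- by move=> x x' y y' _ IHx _ IHy v; rewrite IHx IHy.
- by move=> x y z v; rewrite addrA.
- by move=> x y v; rewrite addrC.
- by move=> x v; rewrite add0r.
- by move=> x v; rewrite addNr.
- by move=> a b x v; rewrite scalerA.
- by move=> x v; rewrite scale1r.
- by move=> a x y v; rewrite scalerDr.
- by move=> a b x v; rewrite scalerDl.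
- by move=> x y z v; rewrite (linD (expr_act_linear x)).
- by move=> a x y v; rewrite (linZ (expr_act_linear x)).
Qed.

End PresentedAction.

Section LeavittAction.
Variables (k : fieldType) (E : nequiver).
Local Notation L := (leavitt k E).
Local Notation vx i := (leavitt_p k (i : vertex E) : L).
Local Notation ar a := (leavitt_arrow k (inl a : arrow (double_quiver E)) : L).
Local Notation st a := (leavitt_arrow k (inr a : arrow (double_quiver E)) : L).

Lemma leavitt_elim (P : L -> Prop) :
  P 0 -> (forall c x y, P x -> P y -> P (c *: x + y)) ->
  (forall x y, P x -> P y -> P (x * y)) ->
  (forall i, P (leavitt_p k i)) ->
  (forall a : arrow (double_quiver E), P (leavitt_arrow k a)) ->
  forall x, P x.
Proof.
move=> P0 PL PM Pv Pa; apply: leavitt_ind => //.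
- by move=> x Px; rewrite -[- x]addr0 -scaleN1r; apply: PL.
- by move=> x y Px Py; rewrite -[x]scale1r; apply: PL.
- by move=> c x Px; rewrite -[_ *: _]addr0; apply: PL.
Qed.

Lemma leavitt1 : (1 : L) = \sum_i vx i.
Proof. by []. Qed.

Lemma leavitt_vertexM (i j : vertex E) :
  vx i * vx j = if i == j then vx i else 0.
Proof. exact: leavitt_pp. Qed.

Lemma leavitt_source_arrow (a : arrow E) : vx (qsource a) * ar a = ar a.
Proof. exact: (leavitt_pa k (inl a : arrow (double_quiver E))). Qed.

Lemma leavitt_arrow_range (a : arrow E) : ar a * vx (qrange a) = ar a.
Proof. exact: (leavitt_ap k (inl a : arrow (double_quiver E))). Qed.

Lemma leavitt_range_ghost (a : arrow E) : vx (qrange a) * st a = st a.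
Proof. exact: (leavitt_pa k (inr a : arrow (double_quiver E))). Qed.

Lemma leavitt_ghost_source (a : arrow E) : st a * vx (qsource a) = st a.
Proof. exact: (leavitt_ap k (inr a : arrow (double_quiver E))). Qed.

Lemma leavitt_ghost_arrow (a b : arrow E) :
  st a * ar b = if a == b then vx (qrange a) else 0.
Proof.
rewrite [LHS]Defs.pi_mul [LHS](leavitt_pi_rel (leavitt_CK1 k a b)).
by case: ifP.
Qed.

Lemma leavitt_pi_sum (I : Type) (r : seq I) (P : pred I) F :
  leavitt_pi (\big[@Add _ _/Zero]_(i <- r | P i) F i)
  = \sum_(i <- r | P i) leavitt_pi (F i) :> L.
Proof.
elim/big_rec2: _ => [//|i x e _ IH].
by rewrite -IH; symmetry; apply: Defs.piD.
Qed.

Lemma leavitt_vertex_sum (i : vertex E) : ~~ sink i ->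
  vx i = \sum_(a : arrow E | qsource a == i) ar a * st a.
Proof.
move=> si; rewrite [LHS](leavitt_pi_rel (leavitt_CK2 k si)) leavitt_pi_sum.
by apply: eq_bigr => a _; symmetry; apply: Defs.pi_mul.
Qed.

Lemma leavitt_source_sum (a : arrow E) :
  \sum_(b : arrow E | qsource b == qsource a) ar b * st b = vx (qsource a).
Proof.
rewrite -leavitt_vertex_sum //; apply/forallPn; exists a; by rewrite negbK.
Qed.

(** The universal property of L, for operators on a vector space.  It is the
    only way in which maps out of L are constructed: it gives derivations, the
    grading, and the action on functions of infinite paths. *)
Lemma leavitt_action (V : lmodType k) (g : leavitt_gen E -> V -> V) :
  (forall x, linear (g x)) ->
  (forall i j v, g (inl i) (g (inl j) v) = if i == j then g (inl i) v else 0) ->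
  (forall (a : arrow (double_quiver E)) v,
     g (inl (qsource a)) (g (inr a) v) = g (inr a) v) ->
  (forall (a : arrow (double_quiver E)) v,
     g (inr a) (g (inl (qrange a)) v) = g (inr a) v) ->
  (forall (a b : arrow E) v, g (inr (inr a)) (g (inr (inl b)) v)
     = if a == b then g (inl (qrange a)) v else 0) ->
  (forall i v, ~~ sink i -> g (inl i) v = \sum_(a : arrow E | qsource a == i)
     g (inr (inl a)) (g (inr (inr a)) v)) ->
  exists rho : L -> V -> V,
    [/\ bilin rho, forall x y v, rho (x * y) v = rho x (rho y v),
        forall i v, rho (leavitt_p k i) v = g (inl i) v
      & forall a v, rho (leavitt_arrow k a) v = g (inr a) v].
Proof.
move=> glin gvv gva gav gck1 gck2.
have gR e e' : leavitt_rel e e' -> expr_act g e =1 expr_act g e'.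
  case=> {e e'} [i j|a|a|a b|i si] v /=.
  - by rewrite gvv; case: ifP.
  - exact: gva.
  - exact: gav.
  - by rewrite gck1; case: ifP.
  - by rewrite gck2 //; elim/big_rec2: _ => [//|a x e _ ->].
pose rho (x : L) := expr_act g (repr (x : presented (@leavitt_rel k E))).
have rho_pi e v : rho (leavitt_pi e) v = expr_act g e v.
  exact/(expr_act_pres glin gR)/pres_repr.
have pi_ex (x : L) : exists e, x = leavitt_pi e.
  by exists (repr (x : presented (@leavitt_rel k E))); rewrite [RHS]reprK.
exists rho; split=> [|x y v|i v|a v]; last 2 first.
- exact: rho_pi.
- exact: rho_pi.
- split=> [v c x y /=|x]; last exact: expr_act_linear.
  have [e ->] := pi_ex x; have [e' ->] := pi_ex y.
  have -> : c *: leavitt_pi e + leavitt_pi e' = leavitt_pi (Add (Scale c e) e').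
    have -> : c *: leavitt_pi e = leavitt_pi (Scale c e) by apply: Defs.piZ.
    exact: Defs.piD.
  by rewrite !rho_pi.
- have [e ->] := pi_ex x; have [e' ->] := pi_ex y.
  have -> : leavitt_pi e * leavitt_pi e' = leavitt_pi (Mul e e').
    exact: Defs.pi_mul.
  by rewrite !rho_pi.
Qed.

End LeavittAction.

(** * Projective modules and change of algebra *)

(** The list sigma x stands for an element of A (x) X over the ground field, and
    it is observed only through bilinear maps H.  In these terms sigma is
    linear, commutes with A acting on the left factor and with the operators b
    acting on the right factor, and is a section of the action map
    A (x) X -> X. *)
Definition split_section (k : fieldType) (A : algType k) (X : amod A)
    (I : Type) (b : I -> X -> X) : Prop :=
  exists sigma : X -> seq (A * X),
    [/\ forall (N : lmodType k) (H : A -> X -> N), bilin H ->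
          linear (fun x => \sum_(q <- sigma x) H q.1 q.2),
        forall (N : lmodType k) (H : A -> X -> N), bilin H -> forall a x,
          \sum_(q <- sigma (act a x)) H q.1 q.2
          = \sum_(q <- sigma x) H (a * q.1) q.2,
        forall (N : lmodType k) (H : A -> X -> N), bilin H -> forall i x,
          \sum_(q <- sigma (b i x)) H q.1 q.2
          = \sum_(q <- sigma x) H q.1 (b i q.2)
      & forall x, \sum_(q <- sigma x) act q.1 q.2 = x].

(** X is then a direct summand of the free module A (x) X. *)
Definition projective (k : fieldType) (A : algType k) (X : amod A) : Prop :=
  split_section (fun (i : void) (x : X) => x).

Section Restriction.
Variables (k : fieldType) (A B : algType k) (f : {lrmorphism B -> A}).
Variable X : amod A.

Fact res_bilin : bilin (fun (b : B) (x : X) => act (f b) x).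
Proof.
by split=> [x c b b'|b]; [rewrite linearP act_linl|apply: act_linr].
Qed.

Fact resM b b' (x : X) : act (f (b * b')) x = act (f b) (act (f b') x).
Proof. by rewrite rmorphM actM. Qed.

Fact res1 (x : X) : act (f 1) x = x.
Proof. by rewrite rmorph1 act1. Qed.

Definition res_amod : amod B := AMod res_bilin resM res1.

End Restriction.

Section Regular.
Variables (k : fieldType) (A : algType k).

Fact regular_bilin : bilin (fun a b : A => a * b).
Proof.
split=> [b c a a'|a c b b']; first by rewrite mulrDl scalerAl.
by rewrite mulrDr scalerAr.
Qed.

Definition regular_amod : amod A :=
  AMod regular_bilin (fun a b c => esym (mulrA a b c)) (@mul1r A).

End Regular.

Section SplitSectionTrans.
Variables (k : fieldType) (A B : algType k) (f : {lrmorphism B -> A}).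
Variables (I : Type) (e : I -> A).

(** If A is projective over B, a projective A-module is projective over B: the
    section is X -> A (x) X -> B (x) A (x) X -> B (x) X, where the last map is
    the action of A.  Elements e i of A which respect the section of A over B
    keep doing so on X. *)
Lemma split_section_trans (X : amod A) :
  split_section (X := res_amod f (regular_amod A))
    (fun i (a : A) => (e i * a : A)) ->
  projective X ->
  split_section (X := res_amod f X) (fun i => @act _ _ X (e i)).
Proof.
move=> [dec [dec_lin decf dece dec1]] [sigma [sigma_lin sigmaA _ sigma1]].
pose tau (x : X) : seq (B * X) :=
  flatten [seq [seq (u.1, act u.2 q.2) | u <- dec q.1] | q <- sigma x].
pose hat (N : lmodType k) (H : B -> X -> N) (a : A) (y : X) :=
  \sum_(u <- dec a) H u.1 (act u.2 y).
have tauE (N : lmodType k) (H : B -> X -> N) x :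
    \sum_(q <- tau x) H q.1 q.2 = \sum_(q <- sigma x) hat N H q.1 q.2.
  rewrite big_flatten big_map; apply: eq_bigr => q _.
  by rewrite big_map.
have slice_bilin (N : lmodType k) (H : B -> X -> N) y : bilin H ->
    bilin (fun (b : B) (a : A) => H b (act a y)).
  move=> [Hl Hr]; split=> [a c b b'|b c a a'] /=; first exact: Hl.
  by rewrite act_linl Hr.
have hat_bilin (N : lmodType k) (H : B -> X -> N) : bilin H -> bilin (hat N H).
  move=> HP; split=> [y|a c y y'] /=.
    exact/(dec_lin _ (fun b a => H b (act a y)))/slice_bilin.
  rewrite /hat scaler_sumr -big_split; apply: eq_bigr => u _ /=.
  by rewrite act_linr HP.2.
exists tau; split=> [N H HP|N H HP b x|N H HP i x|x].
- move=> c x y; rewrite !tauE; exact/(sigma_lin _ (hat N H))/hat_bilin.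
- rewrite !tauE sigmaA; last exact: hat_bilin.
  rewrite (tauE _ (fun b' => H (b * b'))); apply: eq_bigr => q _.
  exact/(decf _ (fun b a => H b (act a q.2)))/slice_bilin.
- rewrite !tauE sigmaA; last exact: hat_bilin.
  rewrite (tauE _ (fun b' y => H b' (act (e i) y))); apply: eq_bigr => q _.
  rewrite [LHS](dece _ (fun b a => H b (act a q.2))); last exact: slice_bilin.
  by apply: eq_bigr => u _; rewrite actM.
- rewrite tauE -[RHS]sigma1; apply: eq_bigr => q _.
  rewrite -[in RHS](dec1 q.1) (lin_sum (act_linl _)).
  by apply: eq_bigr => u _; rewrite /= actM.
Qed.

End SplitSectionTrans.

Section TensorFactors.
Variables (k : fieldType) (A B : algType k).
Local Notation T := (tens A B).

Definition tens_inr (b : B) : T := tpure 1 b.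

Fact tens_inr_linear : linear tens_inr.
Proof. by move=> c b b'; rewrite /tens_inr tpureDr tpureZr. Qed.

HB.instance Definition _ := GRing.isLinear.Build k B T _ tens_inr
  tens_inr_linear.

Fact tens_inr_monoid : monoid_morphism tens_inr.
Proof. by split=> // b b'; rewrite /tens_inr tpureM mulr1. Qed.

HB.instance Definition _ := GRing.isMonoidMorphism.Build B T tens_inr
  tens_inr_monoid.

Lemma tens_inlr a b : @tens_inl k A B a * tens_inr b = tpure a b.
Proof. by rewrite tpureM mulr1 mul1r. Qed.

Lemma tens_inrl a b : tens_inr b * @tens_inl k A B a = tpure a b.
Proof. by rewrite tpureM mulr1 mul1r. Qed.

Section Lift.
Variables (N : lmodType k) (h : A -> B -> N).
Hypothesis hP : bilin h.

Lemma bilin_map : bilinear_map h.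
Proof.
split=> [a a' b|a b b'|a c b].
- exact: (linD (hP.1 b)).
- exact: (linD (hP.2 a)).
- by rewrite (linZ (hP.2 a)) (linZ (hP.1 b)).
Qed.

Lemma tens_lift_lin : linear (tens_lift h : T -> N).
Proof.
move=> c x y; rewrite (tens_liftD bilin_map); congr (_ + _).
elim/tens_ind: x => [|x x' IH IH'|a b].
- by rewrite scaler0 (tens_lift0 bilin_map) scaler0.
- by rewrite scalerDr !(tens_liftD bilin_map) IH IH' scalerDr.
- rewrite -tpureZl !(tens_lift_pure bilin_map).
  exact: (linZ (hP.1 b)).
Qed.

End Lift.

Lemma tens_lift_eq (N : lmodType k) (h : A -> B -> N) (g : T -> N) x :
  bilin h -> linear g -> (forall a b, h a b = g (tpure a b)) ->
  tens_lift h x = g x.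
Proof.
move=> hP glin hg; elim/tens_ind: x => [|x y IHx IHy|a b].
- by rewrite (tens_lift0 (bilin_map hP)) (lin0 glin).
- by rewrite (tens_liftD (bilin_map hP)) IHx IHy (linD glin).
- by rewrite (tens_lift_pure (bilin_map hP)).
Qed.

(** A (x) B is the free A-module on B, through a (x) b |-> a (x) (1 (x) b). *)
Lemma tens_split_inl :
  projective (res_amod (@tens_inl k A B) (regular_amod T)).
Proof.
pose dec (x : T) : seq (A * T) := [seq (q.1, tens_inr q.2) | q <- repr x].
have decE (N : lmodType k) (H : A -> T -> N) x :
    \sum_(q <- dec x) H q.1 q.2 = tens_lift (fun a b => H a (tens_inr b)) x.
  by rewrite big_map.
have slice (N : lmodType k) (H : A -> T -> N) : bilin H ->
    bilin (fun a b => H a (tens_inr b)).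
  move=> [Hl Hr]; split=> [b c a a'|a c b b'] /=; first exact: Hl.
  by rewrite linearP Hr.
exists dec; split=> [N H HP|N H HP a x|N H HP []|x].
- move=> c x y; rewrite !decE; exact/tens_lift_lin/slice.
- rewrite (decE _ (fun a' => H (a * a'))) decE.
  symmetry; apply: (@tens_lift_eq _ _ (fun x => tens_lift _ (tens_inl B a * x))).
  + split=> [b c a' a''|a' c b b'] /=.
      by rewrite mulrDr -scalerAr HP.1.
    by rewrite linearP HP.2.
  + move=> c y z /=; rewrite mulrDr -scalerAr; exact/tens_lift_lin/slice.
  + move=> a' b; rewrite tpureM mul1r tens_lift_pure //.
    exact/bilin_map/slice.
- rewrite decE /=; apply: (@tens_lift_eq _ _ id) => [|//|a b].
    exact/(slice T (fun a y => tens_inl B a * y))/(res_bilin _ (regular_amod T)).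
  exact: tens_inlr.
Qed.

(** The section a (x) b |-> b (x) (a (x) 1) only moves the B-component, hence
    it also commutes with left multiplication by A. *)
Lemma tens_split_inr :
  split_section (X := res_amod tens_inr (regular_amod T))
    (fun a (x : T) => (tens_inl B a * x : T)).
Proof.
pose dec (x : T) : seq (B * T) := [seq (q.2, tens_inl B q.1) | q <- repr x].
have decE (N : lmodType k) (H : B -> T -> N) x :
    \sum_(q <- dec x) H q.1 q.2 = tens_lift (fun a b => H b (tens_inl B a)) x.
  by rewrite big_map.
have slice (N : lmodType k) (H : B -> T -> N) : bilin H ->
    bilin (fun a b => H b (tens_inl B a)).
  move=> [Hl Hr]; split=> [b c a a'|a c b b'] /=; last exact: Hl.
  by rewrite linearP Hr.
exists dec; split=> [N H HP|N H HP b x|N H HP a x|x].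
- move=> c x y; rewrite !decE; exact/tens_lift_lin/slice.
- rewrite (decE _ (fun b' => H (b * b'))) decE.
  symmetry; apply: (@tens_lift_eq _ _ (fun x => tens_lift _ (tens_inr b * x))).
  + split=> [b' c a a'|a c b' b''] /=.
      by rewrite linearP HP.2.
    by rewrite mulrDr -scalerAr HP.1.
  + move=> c y z /=; rewrite mulrDr -scalerAr; exact/tens_lift_lin/slice.
  + move=> a b'; rewrite tpureM mul1r tens_lift_pure //.
    exact/bilin_map/slice.
- rewrite (decE _ (fun b x => H b (tens_inl B a * x))) decE.
  symmetry; apply: (@tens_lift_eq _ _ (fun x => tens_lift _ (tens_inl B a * x))).
  + split=> [b c a' a''|a' c b b'] /=; last exact: HP.1.
    by rewrite linearP mulrDr -scalerAr HP.2.
  + move=> c y z /=; rewrite mulrDr -scalerAr; exact/tens_lift_lin/slice.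
  + move=> a' b; rewrite [in RHS]tpureM mul1r tens_lift_pure;
      last exact/bilin_map/slice.
    by rewrite -rmorphM.
- rewrite decE /=; apply: (@tens_lift_eq _ _ id) => [|//|a b].
    exact/(slice T (fun b y => tens_inr b * y))/(res_bilin _ (regular_amod T)).
  exact: tens_inrl.
Qed.

End TensorFactors.

(** * Derivations of Leavitt path algebras *)

Section LeavittDerivation.
Variables (k : fieldType) (E : nequiver).
Local Notation L := (leavitt k E).
Local Notation vx i := (leavitt_p k (i : vertex E) : L).
Local Notation ar a := (leavitt_arrow k (inl a : arrow (double_quiver E)) : L).
Local Notation st a := (leavitt_arrow k (inr a : arrow (double_quiver E)) : L).

Variables (X Y : amod L) (delta : arrow E -> X -> Y).
Hypothesis delta_lin : forall a, linear (delta a).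
Hypothesis delta_source : forall a x,
  act (vx (qsource a)) (delta a x) = delta a x.
Hypothesis delta_range : forall a x,
  delta a (act (vx (qrange a)) x) = delta a x.

(** Write a' for the ghost arrow of a.  This is the value at a' forced on a
    derivation D which is delta on arrows and 0 on vertices: since a' b is a
    vertex or 0, (D a') b = - a' (D b), and then D a' = \sum_b (D a') b b'. *)
Definition ghost_delta (a : arrow E) (x : X) : Y :=
  - \sum_(b : arrow E | qsource b == qsource a)
      act (st a) (delta b (act (st b) x)).

Lemma ghost_delta_lin a : linear (ghost_delta a).
Proof.
move=> c x y; rewrite /ghost_delta scalerN -opprD scaler_sumr -big_split /=.
congr (- _); apply: eq_bigr => b _.
by rewrite act_linr delta_lin act_linr.
Qed.

(** The upper triangular operators l |-> (l D(l); 0 l) on Y * X form an action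
    of L exactly when D is a derivation; this turns the existence of D into the
    existence of an action. *)
Definition twisted_act (x : leavitt_gen E) (v : (Y * X)%type) : (Y * X)%type :=
  match x with
  | inl i => (act (vx i) v.1, act (vx i) v.2)
  | inr (inl a) => (act (ar a) v.1 + delta a v.2, act (ar a) v.2)
  | inr (inr a) => (act (st a) v.1 + ghost_delta a v.2, act (st a) v.2)
  end.

(** L is quasi-free: derivations have free values on the arrows, as the
    relations between vertices, arrows and ghost arrows determine the rest and
    impose nothing more. *)
Lemma leavitt_derivation : exists D : L -> X -> Y,
  [/\ bilin D,
      forall l m x, D (l * m) x = act l (D m x) + D l (act m x),
      forall i x, D (vx i) x = 0,
      forall a x, D (ar a) x = delta a x
    & forall a x, D (st a) x = ghost_delta a x].
Proof.
have act0l (Z : amod L) (x : Z) : act 0 x = 0 by apply: (lin0 (act_linl x)).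
have [||||||rho [[rhol rhor] rhoM rhov rhoa]] :=
    @leavitt_action k E (Y * X)%type twisted_act.
- case=> [i|[a|a]] c [y x] [y' x'] /=; congr pair => /=; try exact: act_linr.
    rewrite act_linr delta_lin; rewrite addrACA scalerDr //.
  by rewrite act_linr ghost_delta_lin; rewrite addrACA scalerDr //.
- move=> i j [y x] /=; rewrite -!actM leavitt_vertexM.
  by case: eqP => // _; rewrite !act0l.
- case=> a [y x] /=; rewrite (linD (act_linr _)) -!actM.
    by rewrite leavitt_source_arrow delta_source.
  rewrite leavitt_range_ghost; congr (_ + _, _).
  rewrite /ghost_delta (linN (act_linr _)) (lin_sum (act_linr _)).
  by congr (- _); apply: eq_bigr => b _; rewrite -actM leavitt_range_ghost.
- case=> a [y x] /=; rewrite -!actM.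
    by rewrite leavitt_arrow_range delta_range.
  rewrite leavitt_ghost_source; congr (_ + _, _).
  rewrite /ghost_delta; congr (- _); apply: eq_bigr => b /eqP sb.
  by rewrite -[act (st b) _]actM -sb leavitt_ghost_source.
- move=> a b [y x] /=; rewrite (linD (act_linr _)) -!actM.
  rewrite leavitt_ghost_arrow -addrA.
  have -> : act (st a) (delta b x) + ghost_delta a (act (ar b) x) = 0.
    have [sab|sab] := eqVneq (qsource b) (qsource a).
      rewrite /ghost_delta (bigD1 b) ?sab //= -actM leavitt_ghost_arrow eqxx.
      rewrite delta_range big1 ?addr0 ?subrr // => c /andP[_ cb].
      rewrite -[act (st c) _]actM leavitt_ghost_arrow (negPf cb) act0l.
      by rewrite (lin0 (delta_lin c)) (lin0 (act_linr _)).
    rewrite -delta_source -actM -leavitt_ghost_source -mulrA leavitt_vertexM.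
    rewrite eq_sym (negPf sab) mulr0 act0l add0r /ghost_delta big1 ?oppr0 //.
    move=> c /eqP sc; rewrite -[act (st c) _]actM leavitt_ghost_arrow.
    have -> : (c == b) = false.
      by apply/eqP => cb; rewrite cb in sc; rewrite sc eqxx in sab.
    by rewrite act0l (lin0 (delta_lin c)) (lin0 (act_linr _)).
  by rewrite addr0; case: eqP => // _; rewrite !act0l.
- move=> i [y x] si /=.
  have vxi (Z : amod L) (z : Z) : act (vx i) z
      = \sum_(a : arrow E | qsource a == i) act (ar a) (act (st a) z).
    rewrite leavitt_vertex_sum // (lin_sum (act_linl z)).
    by apply: eq_bigr => a _; rewrite actM.
  rewrite [RHS]surjective_pairing; congr pair.
    rewrite (raddf_sum (fst : (Y * X)%type -> Y)) /=.
    rewrite big_split /= vxi -[LHS]addr0.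
    under [X in _ = X + _]eq_bigr => a _ do rewrite (linD (act_linr _)).
    rewrite big_split /= -addrA; congr (_ + _).
    rewrite [X in X + _](_ : _ = - \sum_(b : arrow E | qsource b == i)
        delta b (act (st b) x)) ?addNr // -sumrN.
    transitivity (\sum_(a : arrow E | qsource a == i)
        \sum_(b : arrow E | qsource b == i)
        - act (ar a) (act (st a) (delta b (act (st b) x)))).
      apply: eq_bigr => a /eqP sa; rewrite /ghost_delta sa (linN (act_linr _)).
      by rewrite (lin_sum (act_linr _)) sumrN.
    rewrite exchange_big /=; apply: eq_bigr => b /eqP sb.
    by rewrite sumrN -vxi -sb delta_source.
  by rewrite (raddf_sum (snd : (Y * X)%type -> X)) /= vxi.
have rhoD c l m v : rho (c *: l + m) v = c *: rho l v + rho m v := rhol v c l m.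
have rhoE l y x : rho l (y, x) = (act l y + (rho l (0, x)).1, act l x).
  elim/leavitt_elim: l y x => [|c l m IHl IHm|l m IHl IHm|i|a] y x.
  - by rewrite !(lin0 (rhol _)) !act0l addr0.
  - rewrite !rhoD [in LHS]IHl [in LHS]IHm act_linl act_linl.
    by congr pair => /=; rewrite scalerDr addrACA.
  - rewrite !rhoM [in LHS]IHm [in LHS]IHl IHm [in RHS]IHl /=.
    by rewrite (lin0 (act_linr _)) add0r !actM (linD (act_linr _)) addrA.
  - by rewrite !rhov /= (lin0 (act_linr _)) addr0.
  - rewrite !rhoa; case: a => a /=; by rewrite (lin0 (act_linr _)) add0r.
exists (fun l x => (rho l (0, x)).1); split=> /=.
- split=> [x c l m|l c x y]; first by rewrite rhol.
  have -> : (0, c *: x + y) = c *: (0, x) + (0, y) :> (Y * X)%type.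
    by congr pair; rewrite /= scaler0 addr0.
  by rewrite rhor.
- move=> l m x; rewrite rhoM [in LHS]rhoE [in LHS]rhoE /=.
  by rewrite (lin0 (act_linr _)) add0r.
- by move=> i x; rewrite rhov /= (lin0 (act_linr _)).
- by move=> a x; rewrite rhoa /= (lin0 (act_linr _)) add0r.
- by move=> a x; rewrite rhoa /= (lin0 (act_linr _)) add0r.
Qed.

End LeavittDerivation.

Section EquivariantSection.
Variables (k : fieldType) (E : nequiver).
Local Notation L := (leavitt k E).
Local Notation vx i := (leavitt_p k (i : vertex E) : L).
Local Notation ar a := (leavitt_arrow k (inl a : arrow (double_quiver E)) : L).
Local Notation st a := (leavitt_arrow k (inr a : arrow (double_quiver E)) : L).

(** Two obstruction groups vanish.  The defect l |-> l t - t l of a section t on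
    K is a derivation into the maps from K to the kernel of d.  As L is
    quasi-free it extends to a derivation D into the maps from X to this
    kernel, and as X has a split section D is inner, D(l) = h l - l h.  Then
    t + h is L-linear on K.  All choices are made B-linearly, where B stands
    for the operators bX and bY. *)
Lemma leavitt_equivariant_section (X Y : amod L) (I : Type)
    (bX : I -> X -> X) (bY : I -> Y -> Y) (K : X -> Prop)
    (d : Y -> X) (t : X -> Y) :
  (forall i, linear (bX i)) -> (forall i, linear (bY i)) ->
  (forall i l x, bX i (act l x) = act l (bX i x)) ->
  (forall i l y, bY i (act l y) = act l (bY i y)) ->
  split_section bX ->
  (forall l x, K x -> K (act l x)) -> (forall y, K (d y)) ->
  linear d -> (forall l y, d (act l y) = act l (d y)) ->
  (forall i y, d (bY i y) = bX i (d y)) ->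
  linear t -> (forall i x, t (bX i x) = bY i (t x)) ->
  (forall z, K z -> d (t z) = z) ->
  exists s : X -> Y,
    [/\ linear s, forall i x, s (bX i x) = bY i (s x),
        forall l z, K z -> s (act l z) = act l (s z)
      & forall z, K z -> d (s z) = z].
Proof.
move=> bXlin bYlin bXL bYL [sigma [sigma_lin sigmaL sigmaB sigma1]] KL Kd.
move=> dlin dL dB tlin tB dt.
have act0l (Z : amod L) (x : Z) : act 0 x = 0 by apply: (lin0 (act_linl x)).
have sum_vx (Z : amod L) (z : Z) : \sum_i act (vx i) z = z.
  by rewrite -(lin_sum (act_linl z)) -[RHS]act1 leavitt1.
(* Averaging over the vertices: t1 commutes with them, so that its defect is
   determined by arrows. *)
pose t1 x := \sum_i act (vx i) (t (act (vx i) x)).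
have t1lin : linear t1.
  move=> c x y; rewrite /t1 scaler_sumr -big_split; apply: eq_bigr => i _ /=.
  by rewrite act_linr tlin act_linr.
have t1B i x : t1 (bX i x) = bY i (t1 x).
  rewrite /t1 (lin_sum (bYlin i)); apply: eq_bigr => j _.
  by rewrite -bXL tB bYL.
have t1vx i x : t1 (act (vx i) x) = act (vx i) (t1 x).
  rewrite /t1 (lin_sum (act_linr _)) (bigD1 i) //= -actM leavitt_vertexM eqxx.
  rewrite [RHS](bigD1 i) //= -[in RHS]actM leavitt_vertexM eqxx.
  congr (_ + _); rewrite !big1 // => j ji; rewrite -actM leavitt_vertexM.
    by rewrite eq_sym (negPf ji) act0l.
  by rewrite (negPf ji) act0l (lin0 tlin) (lin0 (act_linr _)).
have dt1 z : K z -> d (t1 z) = z.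
  move=> Kz; rewrite /t1 (lin_sum dlin) -[RHS]sum_vx; apply: eq_bigr => i _.
  by rewrite dL dt; [rewrite -actM leavitt_vertexM eqxx|apply: KL].
(* The defect is extended from K to X along the projection d t1 : X -> K. *)
pose delta a x := act (ar a) (t1 (d (t1 x))) - t1 (act (ar a) (d (t1 x))).
have [||| D [[Dl Dr] DM Dv Da Ds]] := @leavitt_derivation k E X Y delta.
- move=> a c x y; rewrite /delta t1lin dlin t1lin !act_linr t1lin.
  by rewrite opprD addrACA scalerBr.
- move=> a x; rewrite /delta (linB (act_linr _)) -t1vx -!actM.
  by rewrite leavitt_source_arrow.
- move=> a x; rewrite /delta !(t1vx, dL) -!actM.
  by rewrite leavitt_arrow_range.
have DB l i x : D l (bX i x) = bY i (D l x).
  elim/leavitt_elim: l x => [|c l m IHl IHm|l m IHl IHm|j|a] x.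
  - by rewrite !(lin0 (Dl _)) (lin0 (bYlin _)).
  - by rewrite [LHS](Dl _) [D _ x in RHS](Dl _) bYlin IHl IHm.
  - by rewrite !DM -bXL IHl IHm -bYL (linD (bYlin _)).
  - by rewrite !Dv (lin0 (bYlin _)).
  have deltaB b y : delta b (bX i y) = bY i (delta b y).
    by rewrite /delta t1B dB t1B -bYL -bXL t1B (linB (bYlin _)).
  case: a => a; rewrite ?Da ?Ds //.
  rewrite /ghost_delta (linN (bYlin _)) (lin_sum (bYlin _)).
  by congr (- _); apply: eq_bigr => b _; rewrite -bXL deltaB -bYL.
have Ddelta b y : d (delta b y) = 0.
  have Ky : K (d (t1 y)) by apply: Kd.
  by rewrite /delta (linB dlin) dL (dt1 _ Ky) (dt1 _ (KL _ _ Ky)) subrr.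
have Dd l x : d (D l x) = 0.
  elim/leavitt_elim: l x => [|c l m IHl IHm|l m IHl IHm|j|a] x.
  - by rewrite !(lin0 (Dl _)) (lin0 dlin).
  - by rewrite [D _ x](Dl _) dlin IHl IHm scaler0 addr0.
  - by rewrite DM (linD dlin) dL IHl IHm (lin0 (act_linr _)) addr0.
  - by rewrite Dv (lin0 dlin).
  case: a => a; rewrite ?Da ?Ds //.
  rewrite /ghost_delta (linN dlin) (lin_sum dlin) big1 ?oppr0 // => b _.
  by rewrite dL Ddelta (lin0 (act_linr _)).
have DK l z : K z -> D l z = act l (t1 z) - t1 (act l z).
  elim/leavitt_elim: l z => [|c l m IHl IHm|l m IHl IHm|j|a] z Kz.
  - by rewrite (lin0 (Dl _)) !act0l (lin0 t1lin) subrr.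
  - rewrite [LHS](Dl _) IHl // IHm // !act_linl t1lin.
    by rewrite opprD addrACA scalerBr.
  - rewrite DM IHm // IHl; last exact: KL.
    by rewrite (linB (act_linr _)) !actM addrA subrK.
  - by rewrite Dv t1vx subrr.
  case: a => a; rewrite ?Da ?Ds; first by rewrite /delta dt1.
  rewrite /ghost_delta /delta.
  have dtK l y : K y -> d (t1 (act l y)) = act l y by move=> Ky; apply/dt1/KL.
  under eq_bigr => b sb do rewrite dtK // (linB (act_linr _)).
  rewrite sumrB opprB; congr (_ - _).
    rewrite -(lin_sum (act_linr _)) -(lin_sum t1lin).
    under eq_bigr => b sb do rewrite -actM.
    rewrite -(lin_sum (act_linl z)) leavitt_source_sum t1vx -actM.
    by rewrite leavitt_ghost_source.
  rewrite (bigD1 a) //= -actM leavitt_ghost_arrow eqxx -t1vx.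
  rewrite -actM leavitt_range_ghost big1 ?addr0 // => b /andP[_ ba].
  by rewrite -actM leavitt_ghost_arrow eq_sym (negPf ba) act0l.
have Dbil : bilin D by [].
(* Hence h (l x) = l h x + D l x, because D is a derivation and sigma is
   L-linear. *)
pose h x := \sum_(q <- sigma x) D q.1 q.2.
have hlin : linear h by apply: sigma_lin.
exists (fun x => t1 x + h x); split=> [c x y|i x|l z Kz|z Kz].
- by rewrite t1lin hlin scalerDr addrACA.
- rewrite t1B (linD (bYlin _)) /h sigmaB // (lin_sum (bYlin _)).
  by congr (_ + _); apply: eq_bigr => q _; rewrite DB.
- have -> : h (act l z) = act l (h z) + D l z.
    rewrite /h sigmaL // (lin_sum (act_linr _)).
    rewrite -[in D l z](sigma1 z) (lin_sum (Dr l)) -big_split /=.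
    by apply: eq_bigr => q _; rewrite DM.
  by rewrite DK // (linD (act_linr _)) addrCA [X in _ + X]addrC subrK addrC.
- rewrite (linD dlin) dt1 // /h (lin_sum dlin) big1 ?addr0 // => q _.
Qed.

End EquivariantSection.

(** * Contractions over tensor products of Leavitt path algebras *)

Record acomplex (k : fieldType) (A : algType k) := AComplex {
  cx : nat -> amod A;
  cd : forall j, cx j.+1 -> cx j;
  cd_lin : forall j, linear (@cd j);
  cd_act : forall j a x, @cd j (act a x) = act a (cd x);
  cd_cd : forall j (x : cx j.+2), cd (cd x) = 0
}.

Arguments cd {k A} C {j} x : rename.

(** The index is shifted: [contraction C e j] concerns cycles of degree j.+1.
    Degree 0 is left out, since a Koszul complex has homology there.  The map t
    is required to commute with the elements e i of A only. *)
Definition contraction (k : fieldType) (A : algType k) (C : acomplex A)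
    (I : Type) (e : I -> A) (j : nat) : Prop :=
  exists t : cx C j.+1 -> cx C j.+2,
    [/\ linear t, forall i x, t (act (e i) x) = act (e i) (t x)
      & forall z, cd C z = 0 -> cd C (t z) = z].

Section Step.
Variables (k : fieldType) (E : nequiver) (A : algType k).
Variable f : {lrmorphism leavitt k E -> A}.
Variables (I : Type) (e : I -> A) (C : acomplex A).
Hypothesis eL : forall i l, e i * f l = f l * e i.
Hypothesis Csplit : forall j,
  split_section (X := res_amod f (cx C j)) (fun i => @act _ _ (cx C j) (e i)).

Lemma contraction_equivariant_on_cycles j : contraction C e j ->
  exists s : cx C j.+1 -> cx C j.+2,
    [/\ linear s,
        forall i x, s (act (e i) x) = act (e i) (s x),
        forall l z, cd C z = 0 -> s (act (f l) z) = act (f l) (s z)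
      & forall z, cd C z = 0 -> cd C (s z) = z].
Proof.
move=> [t [tlin te dt]].
apply: (@leavitt_equivariant_section k E (res_amod f (cx C j.+1))
  (res_amod f (cx C j.+2)) I (fun i => @act _ _ (cx C j.+1) (e i))
  (fun i => @act _ _ (cx C j.+2) (e i)) (fun z => cd C z = 0)
  (cd C (j:=j.+1)) t)
  => //=.
- by move=> i; apply: act_linr.
- by move=> i; apply: act_linr.
- by move=> i l x; rewrite -!actM eL.
- by move=> i l x; rewrite -!actM eL.
- by move=> l x dx; rewrite cd_act dx (lin0 (act_linr _)).
- exact: cd_cd.
- exact: cd_lin.
- by move=> l y; rewrite cd_act.
- by move=> i y; rewrite cd_act.
Qed.

(** One more tensor factor costs one degree.  The section s of degree j is
    L-linear on cycles, and a boundary is a cycle, so x - s (d x) is a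
    projection onto the cycles of the next degree which is L-linear everywhere;
    the section t of that degree only has to be L-linear on cycles. *)
Lemma contraction_step j : contraction C e j -> contraction C e j.+1 ->
  exists t : cx C j.+2 -> cx C j.+3,
    [/\ linear t, forall i x, t (act (e i) x) = act (e i) (t x),
        forall l x, t (act (f l) x) = act (f l) (t x)
      & forall z, cd C z = 0 -> cd C (t z) = z].
Proof.
move=> /contraction_equivariant_on_cycles[s [slin se sL ds]].
move=> /contraction_equivariant_on_cycles[t [tlin te tL dt]].
pose p (x : cx C j.+2) := x - s (cd C x).
have plin : linear p.
  by move=> c x y; rewrite /p cd_lin slin opprD addrACA scalerBr.
have dp x : cd C (p x) = 0.
  by rewrite /p (linB (@cd_lin _ _ C _)) ds ?subrr // cd_cd.
exists (t \o p); split=> [c x y|i x|l x|z dz] /=.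
- by rewrite plin tlin.
- by rewrite -te /p cd_act se (linB (act_linr _)).
- by rewrite -tL // /p cd_act sL ?(linB (act_linr _)) // cd_cd.
- by rewrite /p dz (lin0 slin) subr0 dt.
Qed.

End Step.

Definition res_acomplex (k : fieldType) (A B : algType k)
    (f : {lrmorphism B -> A}) (C : acomplex A) : acomplex B :=
  @AComplex k B (fun j => res_amod f (cx C j)) (@cd _ _ C) (@cd_lin _ _ C)
    (fun j b => @cd_act _ _ C j (f b)) (@cd_cd _ _ C).

(** The two families of operators are equal, but not convertible. *)
Lemma split_section_void (k : fieldType) (A : algType k) (X : amod A)
    (b b' : void -> X -> X) : split_section b -> split_section b'.
Proof.
move=> [sigma [s1 s2 s3 s4]]; exists sigma; split=> // N H _ [].
Qed.

(** This is the bound n.+1 on the homological dimension of a tensor product of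
    n.+1 Leavitt path algebras, for complexes: linearity over the whole algebra
    is acquired one factor at a time, and each factor costs one degree. *)
Theorem leavitt_tensor_contraction (k : fieldType) (n : nat)
    (E : 'I_n.+1 -> nequiver)
    (C : acomplex (fintens (fun i => leavitt k (E i)))) :
  (forall j, projective (cx C j)) ->
  (forall j, contraction C (fun i : void => match i with end) j) ->
  forall j, (n < j)%N -> contraction C id j.
Proof.
elim: n E C => [|n IH] E C Cproj Ccon j nj.
  case: j nj => // j _.
  have [||t [tlin _ tL dt]] := @contraction_step k (E ord0)
    (leavitt k (E ord0)) idfun void (fun i => match i with end) C _ _ j
    (Ccon j) (Ccon j.+1).
  - by case.
  - by move=> i; apply: split_section_void (Cproj i).
  - by exists t.
pose B := fintens (fun i : 'I_n.+1 =>
  leavitt k (E (widen_ord (leqnSn n.+1) i))).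
pose L : algType k := leavitt k (E ord_max).
pose CB := res_acomplex (@tens_inl k B L) C.
have CBproj i : projective (cx CB i).
  apply: split_section_void (split_section_trans (e := fun v : void => 1)
    _ (Cproj i)).
  exact: split_section_void (tens_split_inl B L).
have Bcon i : (n < i)%N -> contraction C (@tens_inl k B L) i.
  move=> ni; have [|//|t [tlin tB dt]] := IH _ CB CBproj _ i.
  - by move=> i'; have [t [tlin _ dt]] := Ccon i'; exists t; split=> // [[]].
  - by exists t.
case: j nj => // j; rewrite ltnS => nj.
have [||t [tlin tB tL dt]] := @contraction_step k (E ord_max) _
  (@tens_inr k B L) B (@tens_inl k B L) C _ _ j (Bcon j nj)
  (Bcon j.+1 (leqW nj)).
- by move=> b l; rewrite tens_inlr tens_inrl.
- by move=> i; apply: split_section_trans (tens_split_inr B L) (Cproj i).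
exists t; split=> // a x; elim/tens_ind: a => [|a b IHa IHb|b l].
- by rewrite !(lin0 (act_linl _)) (lin0 tlin).
- by rewrite !(linD (act_linl _)) (linD tlin) IHa IHb.
- by rewrite -tens_inlr !actM tB tL.
Qed.

(** * The Koszul complex *)

Section ProductModules.
Variables (k : fieldType) (A : algType k).

Fact zero_bilin : bilin (fun (_ : A) (_ : 'rV[k]_0) => 0 : 'rV[k]_0).
Proof. by split=> z c x y; rewrite /= scaler0 addr0. Qed.

Definition zero_amod : amod A :=
  AMod zero_bilin (fun _ _ _ => erefl) (fun x => esym (thinmx0 x)).

Variables X Y : amod A.

Definition prod_act (a : A) (z : (X * Y)%type) : (X * Y)%type :=
  (act a z.1, act a z.2).

Fact prod_bilin : bilin prod_act.
Proof.
split=> [z c a a'|a c z z']; first by rewrite /prod_act !act_linl.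
by rewrite /prod_act /= !act_linr.
Qed.

Fact prod_actM a b z : prod_act (a * b) z = prod_act a (prod_act b z).
Proof. by rewrite /prod_act !actM. Qed.

Fact prod_act1 z : prod_act 1 z = z.
Proof. by case: z => x y; rewrite /prod_act !act1. Qed.

Definition prod_amod : amod A := AMod prod_bilin prod_actM prod_act1.

Lemma projective_zero : projective zero_amod.
Proof.
exists (fun _ => [::]); split=> [N H _|N H _ a x|N H _ []|x].
- by move=> c x y; rewrite !big_nil scaler0 addr0.
- by rewrite !big_nil.
- by rewrite big_nil [RHS]thinmx0.
Qed.

Lemma projective_prod :
  projective X -> projective Y -> projective prod_amod.
Proof.
move=> [s [slin sA _ s1]] [t [tlin tA _ t1]].
pose tau (z : prod_amod) : seq (A * prod_amod) :=
  [seq (q.1, (q.2, 0)) | q <- s z.1] ++ [seq (q.1, (0, q.2)) | q <- t z.2].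
have tauE (N : lmodType k) (H : A -> prod_amod -> N) z :
    \sum_(q <- tau z) H q.1 q.2
    = \sum_(q <- s z.1) H q.1 (q.2, 0) + \sum_(q <- t z.2) H q.1 (0, q.2).
  by rewrite big_cat !big_map.
have H1P (N : lmodType k) (H : A -> prod_amod -> N) : bilin H ->
    bilin (fun a x => H a (x, 0)).
  move=> [Hl Hr]; split=> [x|a c x x'] /=; first exact: Hl.
  rewrite -Hr; congr (H a _); congr pair => /=; by rewrite scaler0 addr0.
have H2P (N : lmodType k) (H : A -> prod_amod -> N) : bilin H ->
    bilin (fun a y => H a (0, y)).
  move=> [Hl Hr]; split=> [y|a c y y'] /=; first exact: Hl.
  rewrite -Hr; congr (H a _); congr pair => /=; by rewrite scaler0 addr0.
exists tau; split=> [N H HP|N H HP a z|N H HP []|z].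
- move=> c z z'; rewrite !tauE (slin _ _ (H1P _ _ HP)) (tlin _ _ (H2P _ _ HP)).
  by rewrite scalerDr addrACA.
- rewrite tauE (tauE _ (fun b => H (a * b))).
  by rewrite (sA _ _ (H1P _ _ HP)) (tA _ _ (H2P _ _ HP)).
- rewrite tauE /= /prod_act /=.
  rewrite [RHS]surjective_pairing -[in RHS](s1 z.1) -[in RHS](t1 z.2).
  have act0 (Z : amod A) a : act a (0 : Z) = 0 by apply: (lin0 (act_linr _)).
  congr pair; rewrite /= ?(raddf_sum (fst : (X * Y)%type -> X))
    ?(raddf_sum (snd : (X * Y)%type -> Y)) /=.
    by rewrite [X in _ + X]big1 ?addr0 // => q _; rewrite act0.
  by rewrite [X in X + _]big1 ?add0r // => q _; rewrite act0.
Qed.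

End ProductModules.

Section Koszul.
Variables (k : fieldType) (A : algType k) (P : amod A).

(** The Koszul complex of m commuting endomorphisms F 0, ..., F m.-1 of P, as an
    iterated mapping cone: [koszul m.+1] is the cone of F m on [koszul m], so
    that its term of degree j is made of binomial (m, j) copies of P. *)
Fixpoint koszul (m j : nat) : amod A :=
  match m, j with
  | 0, 0 => P
  | 0, _.+1 => zero_amod A
  | m.+1, 0 => koszul m 0
  | m.+1, j.+1 => prod_amod (koszul m j.+1) (koszul m j)
  end.

Lemma koszul_projective m j : projective P -> projective (koszul m j).
Proof.
move=> Pproj; elim: m j => [|m IH] [|j] //=; first exact: projective_zero.
exact: projective_prod.
Qed.

Fixpoint koszul_map (g : P -> P) (m j : nat) : koszul m j -> koszul m j :=
  match m, j with
  | 0, 0 => g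
  | 0, _.+1 => id
  | m.+1, 0 => koszul_map g (m:=m) (j:=0)
  | m.+1, j.+1 => fun x => (koszul_map g x.1, koszul_map g x.2)
  end.

Lemma koszul_map_lin g m j : linear g -> linear (@koszul_map g m j).
Proof.
move=> glin; elim: m j => [|m IH] [|j] //=.
by move=> c x y; rewrite !IH.
Qed.

Lemma koszul_map_act g m j a : (forall x, g (act a x) = act a (g x)) ->
  forall x, @koszul_map g m j (act a x) = act a (koszul_map g x).
Proof.
move=> ga; elim: m j => [|m IH] [|j] //= x; by rewrite /prod_act /= ?IH.
Qed.

Lemma koszul_map_comm g h m j : (forall x, g (h x) = h (g x)) ->
  forall x, @koszul_map g m j (koszul_map h x) = koszul_map h (koszul_map g x).
Proof. by move=> gh; elim: m j => [|m IH] [|j] //= x; rewrite ?IH. Qed.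

Lemma koszul_mapK g h m j : (forall x, g (h x) = x) ->
  forall x, @koszul_map g m j (koszul_map h x) = x.
Proof.
by move=> gh; elim: m j => [|m IH] [|j] //= x; rewrite ?IH //; case: x.
Qed.

Variable F : nat -> P -> P.
Hypothesis Flin : forall i, linear (F i).
Hypothesis FA : forall i a x, F i (act a x) = act a (F i x).
Hypothesis Fcomm : forall i j x, F i (F j x) = F j (F i x).

Fixpoint koszul_d (m j : nat) : koszul m j.+1 -> koszul m j :=
  match m, j with
  | 0, _ => fun _ => 0
  | m.+1, 0 => fun x => koszul_d x.1 + koszul_map (F m) x.2
  | m.+1, j.+1 => fun x =>
      (koszul_d x.1 + koszul_map (F m) x.2, - koszul_d x.2)
  end.

Lemma koszul_d_lin m j : linear (@koszul_d m j).
Proof.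
have Flin' i m' j' := @koszul_map_lin (F i) m' j' (Flin i).
elim: m j => [|m IH] [|j] c x y /=; try by rewrite scaler0 addr0.
  by rewrite IH Flin' scalerDr addrACA.
rewrite !IH Flin'; congr pair => /=; first by rewrite scalerDr addrACA.
by rewrite opprD scalerN.
Qed.

Lemma koszul_d_act m j a x : @koszul_d m j (act a x) = act a (koszul_d x).
Proof.
have act0 (Z : amod A) : act a (0 : Z) = 0 by apply: (lin0 (act_linr _)).
have FmA i := koszul_map_act (FA i a).
elim: m j x => [|m IH] [|j] x; rewrite ?act0 //=.
  by rewrite IH FmA (linD (act_linr _)).
by rewrite /prod_act /= !IH FmA (linD (act_linr _)) (linN (act_linr _)).
Qed.

(** g need not be linear over A: it may be one of the operators R i that witness
    regularity. *)
Lemma koszul_d_map g m j : linear g ->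
  (forall i x, (i < m)%N -> g (F i x) = F i (g x)) ->
  forall x, @koszul_d m j (koszul_map g x) = koszul_map g (koszul_d x).
Proof.
move=> glin; have glin' m' j' := @koszul_map_lin g m' j' glin.
elim: m j => [|m IH] [|j] gF x; rewrite ?(lin0 (glin' _ _)) //=.
  rewrite IH => [|i y im]; last exact/gF/ltnW.
  rewrite (linD (glin' _ _)); congr (_ + _); symmetry.
  by apply: koszul_map_comm => y; rewrite gF.
rewrite !IH => [|i y im|i y im]; try exact/gF/ltnW.
rewrite (linD (glin' _ _)) (linN (glin' _ _)); congr (_ + _, _); symmetry.
by apply: koszul_map_comm => y; rewrite gF.
Qed.

Lemma koszul_d_d m j (x : koszul m j.+2) : koszul_d (koszul_d x) = 0.
Proof.
elim: m j x => [|m IH] // j x.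
have dlin m' j' := @koszul_d_lin m' j'.
have dF j' (y : koszul m j'.+1) : koszul_d (koszul_map (F m) y)
  = koszul_map (F m) (koszul_d y) by apply: koszul_d_map.
have Flin' j' := @koszul_map_lin (F m) m j' (Flin m).
case: j x => [|j] x /=; rewrite (linD (dlin _ _)) dF IH add0r.
  by rewrite (linN (Flin' _)) subrr.
rewrite !(linN (Flin' _)) subrr (linN (dlin _ _)) IH oppr0 oppr0.
by [].
Qed.

Definition koszul_complex (m : nat) : acomplex A :=
  @AComplex k A (koszul m) (@koszul_d m) (@koszul_d_lin m) (@koszul_d_act m)
    (@koszul_d_d m).

(** If (a, b) is a cycle of the cone of F, then d a + F b = 0, hence
    b = - R (d a) = - d (R a); so (a, b) is the boundary of (t (a - F (R a)), R a),
    where t is the contraction for the previous endomorphisms.  The operators R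
    are only linear over the ground field. *)
Lemma koszul_contraction (R : nat -> P -> P) m j :
  (forall i, linear (R i)) -> (forall i x, R i (F i x) = x) ->
  (forall i l x, (l < i)%N -> R i (F l x) = F l (R i x)) ->
  exists2 t : koszul m j.+1 -> koszul m j.+2,
    linear t & forall z, koszul_d z = 0 -> koszul_d (t z) = z.
Proof.
move=> Rlin RF Rcomm; elim: m j => [|m IH] j.
  exists (fun=> 0) => [c x y|z _]; first by rewrite scaler0 addr0.
  by rewrite [RHS]thinmx0.
have [t tlin dt] := IH j.
have Flin' j' := @koszul_map_lin (F m) m j' (Flin m).
have Rlin' j' := @koszul_map_lin (R m) m j' (Rlin m).
have dlin j' := @koszul_d_lin m j'.
have dF j' (y : koszul m j'.+1) : koszul_d (koszul_map (F m) y)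
  = koszul_map (F m) (koszul_d y) by apply: koszul_d_map.
have dR j' (y : koszul m j'.+1) : koszul_d (koszul_map (R m) y)
    = koszul_map (R m) (koszul_d y).
  by apply: koszul_d_map => // i x im; apply: Rcomm.
pose r (a : koszul m j.+1) := a - koszul_map (F m) (koszul_map (R m) a).
exists (fun z : koszul m.+1 j.+1 => (t (r z.1), koszul_map (R m) z.1))
  => [c x y|].
  rewrite /= Rlin' -[RHS]/(_, _); congr pair => //=.
  rewrite -tlin; congr t.
  by rewrite /r Rlin' Flin' opprD addrACA scalerBr.
move=> [a b] /= dz.
have daFb : koszul_d a + koszul_map (F m) b = 0.
  by case: {t IH tlin dt r} j a b dz => [|j] a b //= [].
have bE : b = - koszul_map (R m) (koszul_d a).
  apply/eqP; rewrite -addr_eq0 -[b in b + _](koszul_mapK (RF m)).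
  by rewrite -(linD (Rlin' _)) addrC daFb (lin0 (Rlin' _)).
congr pair; last by rewrite dR -bE.
rewrite dt ?subrK // /r (linB (dlin _)) dF dR.
by rewrite -[X in _ - X]opprK -(linN (Flin' _)) -bE opprK.
Qed.

Fixpoint koszul_top (m : nat) : P -> koszul m m :=
  match m with 0 => id | m.+1 => fun p => (0, koszul_top m p) end.

Fixpoint koszul_of_top (m : nat) : koszul m m -> P :=
  match m with 0 => id | m.+1 => fun x => koszul_of_top x.2 end.

Lemma koszul_topK m p : koszul_of_top (koszul_top m p) = p.
Proof. by elim: m. Qed.

Lemma koszul_top_lin m : linear (koszul_top m).
Proof.
elim: m => [|m IH] //= c x y; rewrite IH.
by congr pair; rewrite /= scaler0 addr0.
Qed.

Lemma koszul_top_act m a p : koszul_top m (act a p) = act a (koszul_top m p).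
Proof.
elim: m => [|m IH] //=.
by rewrite IH /prod_act /= (lin0 (act_linr _)).
Qed.

Lemma koszul_map_top g m p :
  linear g -> @koszul_map g m m (koszul_top m p) = koszul_top m (g p).
Proof.
move=> glin; elim: m => [|m IH] //=.
by rewrite IH (lin0 (@koszul_map_lin g m m.+1 glin)).
Qed.

Lemma koszul_of_top_lin m : linear (@koszul_of_top m).
Proof. by elim: m => [|m IH] //= c x y; rewrite IH. Qed.

Lemma koszul_of_top_act m a x :
  @koszul_of_top m (act a x) = act a (koszul_of_top x).
Proof. by elim: m x => [|m IH] //= x; rewrite IH. Qed.

(** The top differential P -> P^m has the maps F i as components, up to sign;
    hence a map t on P^m is a sum of maps G i composed with them. *)
Lemma koszul_d_top m (t : koszul m.+1 m -> P) :
  linear t -> (forall a x, t (act a x) = act a (t x)) ->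
  exists G : nat -> P -> P,
    [/\ forall i, linear (G i), forall i a x, G i (act a x) = act a (G i x)
      & forall p, t (koszul_d (koszul_top m.+1 p))
          = \sum_(i < m.+1) G i (F i p)].
Proof.
elim: m t => [|m IH] t tlin tA.
  exists (fun=> t); split=> // p.
  by rewrite big_ord_recl big_ord0 addr0 /= add0r.
pose t' (x : koszul m.+1 m) : P := - t (0, x).
have act0 (Z : amod A) a : act a (0 : Z) = 0 by apply: (lin0 (act_linr _)).
have [||G [Glin GA GE]] := IH t'.
- move=> c x y; rewrite /t' scalerN -opprD -tlin; congr (- t _).
  by congr pair; rewrite /= scaler0 addr0.
- move=> a x; rewrite /t' (linN (act_linr _)) -tA; congr (- t _).
  by congr pair; rewrite [RHS]act0.
pose top := koszul_top m.+1.
exists (fun i => if i == m.+1 then fun p => t (top p, 0) else G i).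
split=> [i|i a x|p].
- case: eqP => // _ c x y; rewrite -tlin /top koszul_top_lin; congr t.
  by congr pair; rewrite /= scaler0 addr0.
- case: eqP => // _; rewrite -tA /top koszul_top_act; congr t.
  by congr pair; rewrite [RHS]act0.
have -> : koszul_d (koszul_top m.+2 p)
    = (top (F m.+1 p), - koszul_d (koszul_top m.+1 p)).
  rewrite -[LHS]/(koszul_d (0 : koszul m.+1 m.+2)
    + koszul_map (F m.+1) (koszul_top m.+1 p), - koszul_d (koszul_top m.+1 p)).
  by rewrite (lin0 (@koszul_d_lin m.+1 m.+1)) add0r koszul_map_top.
rewrite big_ord_recr /= eqxx.
under eq_bigr => i _ do rewrite (ltn_eqF (ltn_ord i)).
rewrite -GE /t' -(linN tlin) -(linD tlin); congr t.
have pairE (U V : zmodType) (x : V) (y : U) :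
    (y, - x) = - (0, x) + (y, 0) :> (U * V)%type.
  by congr pair; rewrite /= ?oppr0 ?add0r ?addr0.
exact: pairE.
Qed.

End Koszul.

Lemma koszul_above (k : fieldType) (A : algType k) (P : amod A) m j :
  (m < j)%N -> forall x : koszul P m j, x = 0.
Proof.
elim: m j => [|m IH] [|j] //=; first by move=> _ x; apply: thinmx0.
rewrite ltnS => mj [x y].
by congr pair; apply: IH => //; apply: leqW.
Qed.

(** The operators R i say that F 0, F 1, ... is a regular sequence, in a form
    that can be transported along functors: each F i has a linear left inverse
    compatible with the previous maps.  The conclusion is an A-linear retraction
    of P -> P^m, p |-> (F i p)_i. *)
Definition koszul_splits (k : fieldType) (A : algType k) (m : nat) : Prop :=
  forall (P : amod A) (F R : nat -> P -> P),
  projective P ->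
  (forall i, linear (F i)) ->
  (forall i a x, F i (act a x) = act a (F i x)) ->
  (forall i j x, F i (F j x) = F j (F i x)) ->
  (forall i, linear (R i)) -> (forall i x, R i (F i x) = x) ->
  (forall i l x, (l < i)%N -> R i (F l x) = F l (R i x)) ->
  exists G : nat -> P -> P,
    [/\ forall i, linear (G i), forall i a x, G i (act a x) = act a (G i x)
      & forall p, \sum_(i < m) G i (F i p) = p].

(** The length n.+3 is what the shift of degrees requires: a contraction at
    cycles of degree n.+2, the last but one, is available by
    [leavitt_tensor_contraction] for j = n.+1. *)
Theorem leavitt_tensor_koszul_splits (k : fieldType) (n : nat)
    (E : 'I_n.+1 -> nequiver) :
  koszul_splits (fintens (fun i => leavitt k (E i))) n.+3.
Proof.
set A := fintens _; move=> P F R Pproj Flin FA Fcomm Rlin RF Rcomm.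
pose C := koszul_complex Flin FA Fcomm n.+3.
have Ccon j : contraction C (fun i : void => match i with end) j.
  have [t tlin dt] := koszul_contraction Flin Fcomm n.+3 j Rlin RF Rcomm.
  by exists t; split=> // [[]].
have Cproj j : projective (cx C j) by apply: koszul_projective.
have [t [tlin tA dt]] := leavitt_tensor_contraction Cproj Ccon (ltnSn n).
have d_inj (z : cx C n.+3) : cd C z = 0 -> z = 0.
  have [s [_ _ ds]] := Ccon n.+2.
  move=> /ds <-; rewrite [s z](@koszul_above k A P n.+3 n.+4) //.
  exact: (lin0 (@cd_lin _ _ C n.+3)).
have td (z : cx C n.+3) : t (cd C z) = z.
  apply/eqP; rewrite -subr_eq0; apply/eqP/d_inj.
  by rewrite (linB (@cd_lin _ _ C _)) dt ?subrr // cd_cd.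
have [||G [Glin GA GE]] :=
  @koszul_d_top k A P F Flin n.+2 (fun x => koszul_of_top (t x)).
- by move=> c x y; rewrite tlin (@koszul_of_top_lin k A P n.+3).
- by move=> a x; rewrite tA (@koszul_of_top_act k A P n.+3).
exists G; split=> // p; rewrite -GE.
by rewrite [t _](td (koszul_top n.+3 p)) koszul_topK.
Qed.

(** * Transfer along a Morita equivalence *)

(** An alias, since M has no canonical structure of vector space over k. *)
Definition scalars (k : fieldType) (C : algType k) (M : lmodType C) : Type := M.

Section Scalars.
Variables (k : fieldType) (C : algType k) (M : lmodType C).
Local Notation N := (scalars M).

HB.instance Definition _ := GRing.Zmodule.on N.

Definition scalars_scale (c : k) (x : N) : N := c%:A *: (x : M).

Fact scalars_scaleA a b x :
  scalars_scale a (scalars_scale b x) = scalars_scale (a * b) x.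
Proof. by rewrite /scalars_scale scalerA -scalerAl mul1r scalerA. Qed.

Fact scalars_scale1 : left_id 1 scalars_scale.
Proof. by move=> x; rewrite /scalars_scale !scale1r. Qed.

Fact scalars_scaleDr : right_distributive scalars_scale +%R.
Proof. by move=> a x y; rewrite /scalars_scale scalerDr. Qed.

Fact scalars_scaleDl x : {morph scalars_scale^~ x : a b / a + b}.
Proof. by move=> a b; rewrite /scalars_scale !scalerDl. Qed.

HB.instance Definition _ := GRing.Zmodule_isLmodule.Build k N
  scalars_scaleA scalars_scale1 scalars_scaleDr scalars_scaleDl.

Lemma scalarsE c (x : N) : c *: x = c%:A *: (x : M) :> M.
Proof. by []. Qed.

End Scalars.

Section LeftModule.
Variables (k : fieldType) (A S : algType k) (P : lmodType (tens A S^c)).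

Lemma lmul_lin : bilin (fun (a : A) (p : scalars P) => lmul a p : scalars P).
Proof.
split=> [p c a a'|a c p p'] /=; rewrite /lmul.
  rewrite tpureDl tpureZl scalerDl; congr (_ + _).
  by rewrite scalarsE scalerA -scalerAl mul1r.
rewrite scalerDr; congr (_ + _).
rewrite !scalarsE !scalerA.
by rewrite -scalerAl mul1r -scalerAr mulr1.
Qed.

Lemma lmulM a b (p : scalars P) : lmul (a * b) p = lmul a (lmul b p).
Proof. by rewrite /lmul scalerA tpureM mulr1. Qed.

Lemma lmul1 (p : scalars P) : lmul 1 p = p.
Proof. exact: scale1r. Qed.

Definition left_amod : amod A := AMod lmul_lin lmulM lmul1.

Lemma rmul_lin : bilin (fun (p : scalars P) (s : S) => rmul p s : scalars P).
Proof.
split=> [s c p p'|p c s s'] /=; rewrite /rmul.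
  rewrite scalerDr; congr (_ + _).
  rewrite !scalarsE !scalerA.
  by rewrite -scalerAl mul1r -scalerAr mulr1.
rewrite tpureDr (tpureZr c (1 : A) (s : S^c)) scalerDl; congr (_ + _).
by rewrite scalarsE scalerA -scalerAl mul1r.
Qed.

Lemma rmulM (p : scalars P) s s' : rmul p (s * s') = rmul (rmul p s) s'.
Proof. by rewrite /rmul scalerA tpureM mulr1. Qed.

Lemma rmul1 (p : scalars P) : rmul p 1 = p.
Proof. exact: scale1r. Qed.

Lemma lmul_rmul a s (p : scalars P) : lmul a (rmul p s) = rmul (lmul a p) s.
Proof. by rewrite /lmul /rmul !scalerA !tpureM !mulr1 !mul1r. Qed.

End LeftModule.

Lemma btens_sum_pure (S : Type) (M N : zmodType) (ract : M -> S -> M)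
    (lact : S -> N -> N) (x : btens ract lact) :
  exists s : seq (M * N), x = \sum_(q <- s) pure ract lact q.1 q.2.
Proof.
elim/btens_ind: x => [|x y [s ->] [t ->]|a b].
- by exists [::]; rewrite big_nil.
- by exists (s ++ t); rewrite big_cat.
- by exists [:: (a, b)]; rewrite big_seq1.
Qed.

Section MoritaPairing.
Variables (k : fieldType) (A S : algType k).
Variables (P : lmodType (tens A S^c)) (Q : lmodType (tens S A^c)).
Variable phi : bimod_tens P Q -> A.
Hypothesis phi_bij : bijective phi.
Hypothesis phiD : forall x y, phi (x + y) = phi x + phi y.
Hypothesis phiB : forall (r r' : A) (p : P) (q : Q),
  phi (bimod_pure (lmul r p) (rmul q r')) = r * phi (bimod_pure p q) * r'.

Definition pairing (p : scalars P) (q : scalars Q) : A := phi (bimod_pure p q).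

Lemma pairing_lmul a p q : pairing (lmul a p) q = a * pairing p q.
Proof. by rewrite /pairing -[q in LHS]rmul1 phiB mulr1. Qed.

Lemma pairing_rmul p q a : pairing p (rmul q a) = pairing p q * a.
Proof. by rewrite /pairing -[p in LHS]lmul1 phiB mul1r. Qed.

Lemma pairing_balanced p s q : pairing (rmul p s) q = pairing p (lmul s q).
Proof. by congr phi; apply: pure_act. Qed.

Lemma pairing_bilin : bilin pairing.
Proof.
have pD p p' q : pairing (p + p') q = pairing p q + pairing p' q.
  by rewrite /pairing -phiD; congr phi; apply: pureDl.
have Dp p q q' : pairing p (q + q') = pairing p q + pairing p q'.
  by rewrite /pairing -phiD; congr phi; apply: pureDr.
have lmulZ c (p : scalars P) : lmul c%:A p = c *: p.
  by have /= -> := linZ ((lmul_lin P).1 p) c 1; rewrite lmul1.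
have rmulZ c (q : scalars Q) : rmul q c%:A = c *: q.
  by have /= -> := linZ ((rmul_lin Q).2 q) c 1; rewrite rmul1.
split=> [q c p p'|p c q q'] /=.
  by rewrite pD -lmulZ pairing_lmul -scalerAl mul1r.
by rewrite Dp -rmulZ pairing_rmul -scalerAr mulr1.
Qed.

Lemma phi_sum (s : seq (P * Q)) :
  phi (\sum_(y <- s) bimod_pure y.1 y.2) = \sum_(y <- s) pairing y.1 y.2.
Proof.
have phi0 : phi 0 = 0 by apply: (addrI (phi 0)); rewrite -phiD !addr0.
by rewrite (big_morph phi phiD phi0).
Qed.

Lemma pairing_unit :
  exists ys : seq (P * Q), \sum_(y <- ys) pairing y.1 y.2 = 1.
Proof.
have [psi _ phiK] := phi_bij.
have [ys ysE] := btens_sum_pure (psi 1).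
by exists ys; rewrite -phi_sum -[X in phi X]ysE phiK.
Qed.

(** As phi is injective, an equality between values of the pairing is an
    equality in P (x) Q, to which any balanced map can be applied. *)
Lemma pairing_lift (V : zmodType) (h : P -> Q -> V) (s t : seq (P * Q)) :
  balanced (@rmul k A S P) (@lmul k S A Q) h ->
  \sum_(y <- s) pairing y.1 y.2 = \sum_(y <- t) pairing y.1 y.2 ->
  \sum_(y <- s) h y.1 y.2 = \sum_(y <- t) h y.1 y.2.
Proof.
move=> hP; rewrite -!phi_sum => /(bij_inj phi_bij).
move=> /(congr1 (fun x => btens_lift h x)).
have liftE r : btens_lift h (\sum_(y <- r) bimod_pure y.1 y.2 : bimod_tens P Q)
    = \sum_(y <- r) h y.1 y.2.
  rewrite (big_morph (fun x => btens_lift h x) (btens_liftD hP) (btens_lift0 hP)).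
  by apply: eq_bigr => y _; apply: btens_lift_pure.
by rewrite !liftE.
Qed.

End MoritaPairing.

Section Morita.
Variables (k : fieldType) (A S : algType k).
Variables (P : lmodType (tens A S^c)) (Q : lmodType (tens S A^c)).
Hypothesis isoPQ : bimod_tens_iso P Q.
Hypothesis isoQP : bimod_tens_iso Q P.
Local Notation X := (left_amod P).

(** The two isomorphisms P (x) Q -> A and Q (x) P -> S are independent of each
    other: (p q) p' and p (q p') need not be equal, but they differ by
    automorphisms u and w of P. *)
Lemma morita_pairings : exists (f : scalars P -> scalars Q -> A)
    (g : scalars Q -> scalars P -> S) (ys : seq (P * Q)) (zs : seq (Q * P))
    (u w : scalars P -> scalars P),
  [/\ bilin f /\ bilin g,
      (forall a p q, f (lmul a p) q = a * f p q)
        /\ (forall q p s, g q (rmul p s) = g q p * s),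
      \sum_(y <- ys) f y.1 y.2 = 1 /\ \sum_(z <- zs) g z.1 z.2 = 1,
      (forall p q p', lmul (f p q) p' = rmul (u p) (g q p'))
        /\ (forall p q p', rmul p (g q p') = lmul (f p q) (w p'))
    & [/\ linear u, forall a p, u (lmul a p) = lmul a (u p)
        & forall p s, u (rmul p s) = rmul (u p) s]].
Proof.
have [phi [phi_bij phiD phiB]] := isoPQ.
have [psi [psi_bij psiD psiB]] := isoQP.
pose f := pairing phi; pose g := pairing psi.
have [ys ys1] := pairing_unit phi_bij phiD.
have [zs zs1] := pairing_unit psi_bij psiD.
have fP : bilin f by apply: pairing_bilin.
have gP : bilin g by apply: pairing_bilin.
have fL a p q : f (lmul a p) q = a * f p q := pairing_lmul phiB a p q.
have fR p q a : f p (rmul q a) = f p q * a := pairing_rmul phiB p q a.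
have fb p s q : f (rmul p s) q = f p (lmul s q) := pairing_balanced phi p s q.
have gL s q p : g (lmul s q) p = s * g q p := pairing_lmul psiB s q p.
have gR q p s : g q (rmul p s) = g q p * s := pairing_rmul psiB q p s.
pose u (p : scalars P) : scalars P := \sum_(z <- zs) lmul (f p z.1) z.2.
pose w (p : scalars P) : scalars P := \sum_(y <- ys) rmul y.1 (g y.2 p).
have lP := lmul_lin P; have rP := rmul_lin P.
have uE p q p' : lmul (f p q) p' = rmul (u p) (g q p').
  have hP : balanced (@rmul k S A Q) (@lmul k A S P)
      (fun q p' => lmul (f p q) p' : scalars P).
    split=> [q1 q2 p1|q1 p1 p2|q1 a p1].
    - by rewrite (linD (fP.2 p)) (linD (lP.1 p1)).
    - exact: (linD (lP.2 _)).
    - by rewrite fR lmulM.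
  have := @pairing_lift k S A Q P psi psi_bij psiD _ _ [:: (q, p')]
    [seq (z.1, rmul z.2 (g q p')) | z <- zs] hP.
  rewrite !big_seq1 !big_map /= => -> //; last first.
    rewrite -/g; under [RHS]eq_bigr => z _ do rewrite gR.
    by rewrite -mulr_suml zs1 mul1r.
  rewrite /u (lin_sum (rP.1 _)); apply: eq_bigr => z _.
  by rewrite lmul_rmul.
have wE p q p' : rmul p (g q p') = lmul (f p q) (w p').
  have hP : balanced (@rmul k A S P) (@lmul k S A Q)
      (fun p q => rmul p (g q p') : scalars P).
    split=> [p1 p2 q1|p1 q1 q2|p1 s q1].
    - exact: (linD (rP.1 _)).
    - by rewrite (linD (gP.1 p')) (linD (rP.2 p1)).
    - by rewrite gL rmulM.
  have := @pairing_lift k A S P Q phi phi_bij phiD _ _ [:: (p, q)]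
    [seq (lmul (f p q) y.1, y.2) | y <- ys] hP.
  rewrite !big_seq1 !big_map /= => -> //; last first.
    rewrite -/f; under [RHS]eq_bigr => y _ do rewrite fL.
    by rewrite -mulr_sumr ys1 mulr1.
  rewrite /w (lin_sum (lP.2 _)); apply: eq_bigr => y _.
  by rewrite lmul_rmul.
exists f, g, ys, zs, u, w; split=> //; split=> [c p p'|a p|p s].
- rewrite /u scaler_sumr -big_split; apply: eq_bigr => z _ /=.
  by rewrite fP.1 lP.1.
- rewrite /u (lin_sum (lP.2 a)); apply: eq_bigr => z _.
  by rewrite fL lmulM.
rewrite {1}/u; under eq_bigr => z _ do rewrite fb uE gL.
by rewrite -(lin_sum (rP.2 (u p))) -mulr_sumr zs1 mulr1.
Qed.

End Morita.

(** Multiplication by s i on P is A-linear and P is a finitely generated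
    projective module on both sides: on the left this makes the Koszul complex
    one of projective modules, and on the right it transports the operators R i
    from S to P.  An A-linear endomorphism of P has the form p |-> u p * c, so
    the retraction of the Koszul complex reads u p * (\sum_i s i * c i) = p, and
    the sum is invertible in S. *)
Theorem morita_koszul_splits (k : fieldType) (A S : algType k) (m : nat)
    (s : nat -> S) (R : nat -> S -> S) :
  morita_equivalent A S -> koszul_splits A m ->
  (forall i j, s i * s j = s j * s i) ->
  (forall i, linear (R i)) -> (forall i x, R i (x * s i) = x) ->
  (forall i l x, (l < i)%N -> R i (x * s l) = R i x * s l) ->
  exists c : nat -> S, \sum_(i < m) s i * c i = 1.
Proof.
move=> [P [Q [isoPQ isoQP]]] Asplit scomm Rlin Rs Rcomm.
have [f [g [ys [zs [u [w [[fP gP] [fL gR] [ys1 zs1] [uE wE] [ulin uL uR]]]]]]]] :=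
  morita_pairings isoPQ isoQP.
pose X := left_amod P.
have lP := lmul_lin P; have rP := rmul_lin P.
have Xproj : projective X.
  exists (fun p => [seq (f p z.1, w z.2 : X) | z <- zs]); split=> //=.
  - move=> N H [Hl Hr] c x y; rewrite !big_map /= scaler_sumr -big_split.
    by apply: eq_bigr => z _ /=; rewrite fP.1 Hl.
  - move=> N H HP a x; rewrite !big_map /=; apply: eq_bigr => z _.
    by rewrite fL.
  - move=> x; rewrite big_map /=; under eq_bigr => z _ do rewrite -wE.
    by rewrite -(lin_sum (rP.2 x)) zs1 rmul1.
have right_basis p : \sum_(y <- ys) rmul (u y.1) (g y.2 p) = p.
  under eq_bigr => y _ do rewrite -uE.
  by rewrite -(lin_sum (lP.1 p)) ys1 lmul1.
pose F i (p : X) : X := rmul p (s i).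
pose RX i (p : X) : X := \sum_(y <- ys) rmul (u y.1) (R i (g y.2 p)).
have [||||||G [Glin GA GE]] :=
    Asplit X F RX Xproj.
- by move=> i; apply: rP.1.
- by move=> i a x; rewrite /F [RHS]lmul_rmul.
- by move=> i j x; rewrite /F -!rmulM scomm.
- move=> i c x y; rewrite /RX scaler_sumr -big_split; apply: eq_bigr => z _ /=.
  by rewrite gP.2 Rlin rP.2.
- move=> i x; rewrite -[RHS]right_basis; apply: eq_bigr => y _.
  by rewrite gR Rs.
- move=> i l x li; rewrite /RX /F (lin_sum (rP.1 (s l))).
  by apply: eq_bigr => y _; rewrite gR Rcomm // rmulM.
have endoE (h : X -> X) : linear h ->
    (forall a x, h (lmul a x) = lmul a (h x)) ->
    exists c, forall p, h p = rmul (u p) c.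
  move=> hlin hA; exists (\sum_(z <- zs) g z.1 (h (w z.2))) => p.
  rewrite -[in LHS](@rmul1 k _ S P p) -zs1 (lin_sum (rP.2 p)) (lin_sum hlin).
  rewrite (lin_sum (rP.2 (u p))); apply: eq_bigr => z _.
  by rewrite wE hA uE.
have [c cE] := choice (fun i => endoE (G i) (Glin i) (GA i)).
have [c2 c2E] : exists c, forall p, u (u p) = rmul (u p) c.
  apply: endoE => [a x y|a x]; first by rewrite ulin ulin.
  by rewrite !uL.
pose c1 := \sum_(i < m) s i * c i.
have uc1 (p : scalars P) : rmul (u p) c1 = p.
  rewrite -[RHS]GE /c1 (lin_sum (rP.2 (u p))); apply: eq_bigr => i _.
  by rewrite cE /F uR rmulM.
have uE2 (p : scalars P) : u p = rmul p c2.
  have up : u (rmul p c1) = p by rewrite uR uc1.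
  by rewrite -up c2E.
have c12 (p : scalars P) : rmul p (c1 * c2) = p.
by rewrite rmulM -uE2 uR uc1.
exists (fun i => c i * c2); under eq_bigr => i _ do rewrite mulrA.
rewrite -mulr_suml -/c1 -[LHS]mul1r -zs1 mulr_suml; apply: eq_bigr => z _.
by rewrite -gR c12.
Qed.

(** * The element attached to a closed path *)

Section ClosedPath.
Variables (k : fieldType) (E : nequiver).
Local Notation L := (leavitt k E).
Local Notation vx i := (leavitt_p k (i : vertex E) : L).
Local Notation ar a := (leavitt_arrow k (inl a : arrow (double_quiver E)) : L).
Local Notation st a := (leavitt_arrow k (inr a : arrow (double_quiver E)) : L).

(** A function v stands for the formal Laurent series \sum_d v d t^d, and arrows
    and ghost arrows act with an additional factor t and t^-1.  Series infinite
    in both directions make constant functions available. *)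
Definition graded_act (x : leavitt_gen E) (v : int -> L) : int -> L :=
  match x with
  | inl i => fun d => vx i * v d
  | inr (inl a) => fun d => ar a * v (d - 1)
  | inr (inr a) => fun d => st a * v (d + 1)
  end.

Lemma leavitt_graded_act : exists rho : L -> (int -> L) -> int -> L,
  [/\ bilin rho, forall x y v, rho (x * y) v = rho x (rho y v),
      forall i v d, rho (vx i) v d = vx i * v d,
      forall a v d, rho (ar a) v d = ar a * v (d - 1)
    & forall a v d, rho (st a) v d = st a * v (d + 1)].
Proof.
have [||||||rho [rhoP rhoM rhov rhoa]] := @leavitt_action k E (int -> L) graded_act.
- by case=> [i|[a|a]] c v w; apply/funext => d; rewrite /= !fctE mulrDr scalerAr.
- move=> i j v; apply/funext => d; rewrite /= mulrA leavitt_vertexM.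
  by case: eqP => // _; rewrite mul0r.
- move=> a v; apply/funext => d; case: a => a; rewrite /= mulrA.
    by rewrite leavitt_source_arrow.
  by rewrite leavitt_range_ghost.
- move=> a v; apply/funext => d; case: a => a; rewrite /= mulrA.
    by rewrite leavitt_arrow_range.
  by rewrite leavitt_ghost_source.
- move=> a b v; apply/funext => d; rewrite /= mulrA addrK leavitt_ghost_arrow.
  by case: eqP => // _; rewrite mul0r.
- move=> i v si; apply/funext => d; rewrite fct_sumE /= leavitt_vertex_sum //.
  by rewrite mulr_suml; apply: eq_bigr => a _; rewrite mulrA subrK.
by exists rho; split=> // *; rewrite (rhov, rhoa).
Qed.

Definition path_prod (q : seq (arrow E)) : L := \prod_(a <- q) ar a.

(** On a constant function, x acts as multiplication by x, and the value of x v
    at 0 depends only on the values of v on some window [-N, N].  Let v be 1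
    from -N on and 0 before.  As x = x c^n, x v is also x (c^n v), and for large
    n the function c^n v vanishes on the window.  Thus x = (x v)(0) = 0. *)
Lemma path_regular (q : seq (arrow E)) x :
  (0 < size q)%N -> x = x * path_prod q -> x = 0.
Proof.
move=> q0 xq; have [rho [[rhol rhor] rhoM rhov rhoa rhos]] := leavitt_graded_act.
have rho0 v : rho 0 v = 0 by apply: (lin0 (rhol v)).
have rhoL c y z v : rho (c *: y + z) v = c *: rho y v + rho z v.
  exact: (rhol v).
have rho_const y z d : rho y (fun=> z) d = y * z.
  elim/leavitt_elim: y z d => [|c y y' IH IH'|y y' IH IH'|i|[a|a]] z d.
  - by rewrite rho0 mul0r.
  - by rewrite rhoL mulrDl -scalerAl -(IH z d) -(IH' z d).
  - rewrite rhoM -mulrA -(IH _ d); congr (rho _ _ _); apply/funext => e.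
    exact: IH'.
  - exact: rhov.
  - exact: rhoa.
  - exact: rhos.
have rho_local y : exists N : nat, forall v w d,
    (forall e, (`|e - d| <= N)%N -> v e = w e) -> rho y v d = rho y w d.
  elim/leavitt_elim: y => [|c y y' [N NP] [N' NP']|y y' [N NP] [N' NP']|i|[a|a]].
  - by exists 0%N => v w d _; rewrite !rho0.
  - exists (maxn N N') => v w d vw; rewrite !rhoL.
    transitivity (c *: rho y v d + rho y' v d) => //.
    rewrite (NP v w) => [|e eN]; last by apply: vw; rewrite leq_max eN.
    by rewrite (NP' v w) // => e eN; apply: vw; rewrite leq_max eN orbT.
  - exists (N + N')%N => v w d vw; rewrite !rhoM; apply: NP => e eN.
    by apply: NP' => e' eN'; apply: vw; lia.
  - by exists 0%N => v w d vw; rewrite !rhov vw //; lia.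
  - by exists 1%N => v w d vw; rewrite !rhoa vw //; lia.
  - by exists 1%N => v w d vw; rewrite !rhos vw //; lia.
have rho_one v : rho 1 v = v.
  apply/funext => d; rewrite leavitt1 (lin_sum (rhol v)) fct_sumE.
  transitivity (\sum_i vx i * v d); first by apply: eq_bigr => i _; rewrite rhov.
  by rewrite -mulr_suml -leavitt1 mul1r.
have rho_path r v d : rho (path_prod r) v d = path_prod r * v (d - (size r)%:Z).
  elim: r v d => [|a r IH] v d.
    by rewrite /path_prod big_nil rho_one mul1r subr0.
  rewrite /path_prod big_cons rhoM rhoa IH mulrA; congr (_ * v _).
  by rewrite -addrA -opprD.
have [N NP] := rho_local x.
pose v (e : int) : L := if - N%:Z <= e then 1 else 0.
pose w n := iter n (rho (path_prod q)) v.
have wE n e : exists y, w n e = y * v (e - (n * size q)%:Z).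
  elim: n e => [|n IH] e; first by exists 1; rewrite mul1r /=; congr v; lia.
  have [y yE] := IH (e - (size q)%:Z).
  exists (path_prod q * y); rewrite /w iterS -/(w n) rho_path yE mulrA.
  congr (_ * v _); lia.
have rho_w n : rho x v = rho x (w n).
  by elim: n => // n ->; rewrite [in LHS]xq rhoM.
have := rho_const x 1 0; rewrite mulr1 => <-.
rewrite -(NP v) => [|e eN]; last by rewrite /v; case: ifP => //; lia.
(* c has length at least 1, so 2 N + 1 steps move the support of v beyond N. *)
rewrite (rho_w (N.*2.+1)) (NP _ (fun=> 0)) ?rho_const ?mulr0 // => e eN.
have [y ->] := wE (N.*2.+1) e.
rewrite /v; case: ifP; rewrite ?mulr0 //.
have : (N.*2.+1 <= N.*2.+1 * size q)%N by rewrite leq_pmulr.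
lia.
Qed.

Definition infinite_path (x : nat -> arrow E) : bool :=
  `[< forall n, qrange (x n) = qsource (x n.+1) >].

Definition ipath_shift (x : nat -> arrow E) (n : nat) : arrow E := x n.+1.

Definition ipath_cons (a : arrow E) (x : nat -> arrow E) (n : nat) : arrow E :=
  if n is m.+1 then x m else a.

Lemma infinite_path_shift x : infinite_path x -> infinite_path (ipath_shift x).
Proof. by move=> /asboolP xP; apply/asboolP => n; apply: xP. Qed.

Lemma infinite_path_cons a x : qsource (x 0%N) = qrange a -> infinite_path x ->
  infinite_path (ipath_cons a x).
Proof. by move=> xa /asboolP xP; apply/asboolP => -[|n] /=. Qed.

Lemma ipath_cons_shift x : ipath_cons (x 0%N) (ipath_shift x) = x.
Proof. by apply/funext => -[]. Qed.

(** L acts on functions of infinite paths by x |-> w (shift x) and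
    x |-> w (a x); on sequences which are not paths all values are 0, which
    saves a type of infinite paths. *)
Definition ipath_act (g : leavitt_gen E) (w : (nat -> arrow E) -> k^o) :
    (nat -> arrow E) -> k^o :=
  match g with
  | inl i => fun x =>
      if infinite_path x && (qsource (x 0%N) == i) then w x else 0
  | inr (inl a) => fun x =>
      if infinite_path x && (x 0%N == a) then w (ipath_shift x) else 0
  | inr (inr a) => fun x =>
      if infinite_path x && (qsource (x 0%N) == qrange a) then w (ipath_cons a x)
      else 0
  end.

Lemma leavitt_ipath_act :
  exists rho : L -> ((nat -> arrow E) -> k^o) -> (nat -> arrow E) -> k^o,
  [/\ bilin rho, forall x y v, rho (x * y) v = rho x (rho y v),
      forall i w, rho (vx i) w = ipath_act (inl i) w
    & forall a w, rho (ar a) w = ipath_act (inr (inl a)) w].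
Proof.
have [||||||rho [rhoP rhoM rhov rhoa]] :=
  @leavitt_action k E ((nat -> arrow E) -> k^o) ipath_act.
- case=> [i|[a|a]] c v w; apply/funext => x; rewrite /= !fctE;
    by case: ifP => //; rewrite scaler0 addr0.
- move=> i j w; apply/funext => x /=.
  case: (eqVneq i j) => [<-|ij] /=; first by case: ifP => // ->.
  case: ifP => // /andP[_ /eqP ->]; by rewrite (negPf ij) andbF.
- move=> [a|a] w; apply/funext => x /=; last by case: ifP => // ->.
  by case: (infinite_path x) => //=; case: (eqVneq (x 0%N) a) => [->|];
    rewrite ?eqxx //; case: ifP.
- move=> [a|a] w; apply/funext => x /=; case: ifP => // /andP[xP /eqP xa].
    rewrite infinite_path_shift //=; move/asboolP: xP => xP.
    by rewrite /ipath_shift -xP xa eqxx.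
  by rewrite infinite_path_cons //= eqxx.
- move=> a b w; apply/funext => x /=.
  case: (a == b); case: ifP => // /andP[xP /eqP xa]; last by rewrite andbF.
  by rewrite infinite_path_cons //= xa eqxx xP.
- move=> i w si; apply/funext => x; rewrite fct_sumE /=.
  have [xP|xP] := boolP (infinite_path x); last by rewrite big1.
  rewrite /=; have shiftE : qsource (ipath_shift x 0%N) = qrange (x 0%N).
    by move/asboolP: xP => xP; rewrite /ipath_shift xP.
  case: (eqVneq (qsource (x 0%N)) i) => [xi|xi]; last first.
    rewrite big1 // => a /eqP ai; case: (eqVneq (x 0%N) a) => // xa.
    by rewrite xa ai eqxx in xi.
  rewrite (bigD1 (x 0%N)) /=; last exact/eqP.
  rewrite eqxx infinite_path_shift // shiftE eqxx /= ipath_cons_shift.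
  rewrite big1 ?addr0 // => a /andP[_ ax].
  by rewrite eq_sym (negPf ax).
by exists rho; split=> // *; rewrite (rhov, rhoa).
Qed.

(** Let z be the periodic path c c c ..., where c is the closed path a :: p.
    Since c w takes at z the value of w at the shift of z by the length of c,
    which is z again, evaluation at z does not distinguish w from c w; apply it
    to x acting on the constant function 1. *)
Lemma closed_path_functional (a : arrow E) (p : seq (arrow E)) :
  path (fun b c => qrange b == qsource c) a p ->
  qrange (last a p) = qsource a ->
  exists lam : L -> k^o,
    [/\ linear lam, lam 1 = 1
      & forall x, lam ((1 - path_prod (a :: p)) * x) = 0].
Proof.
move=> ap pa; have [rho [[rhol rhor] rhoM rhov rhoa]] := leavitt_ipath_act.
pose q := a :: p.
pose z n := nth a q (n %% size q).
have zP : infinite_path z.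
  apply/asboolP => n; rewrite /z.
  have q0 : (0 < size q)%N by [].
  have nq : (n %% size q < size q)%N by rewrite ltn_mod.
  rewrite -addn1 -modnDml.
  move: nq; rewrite leq_eqVlt => /orP[/eqP nq|nq].
    rewrite addn1 nq modnn /= -pa.
    have -> : (n %% size q)%N = size p by move: nq => [].
    by rewrite -last_nth.
  rewrite addn1 (modn_small nq).
  have /(pathP a)/(_ (n %% size q)%N) : path (fun b c => qrange b == qsource c) a p.
    exact: ap.
  by move=> /(_ nq) /eqP.
have rho_one w x : infinite_path x -> rho 1 w x = w x.
  move=> xP; rewrite leavitt1 (lin_sum (rhol w)) fct_sumE.
  rewrite (bigD1 (qsource (x 0%N))) //= rhov /= xP eqxx /= big1 ?addr0 //.
  by move=> i ix; rewrite rhov /= xP eq_sym (negPf ix).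
have rho_path r w x : infinite_path x ->
    (forall i, (i < size r)%N -> x i = nth a r i) ->
    rho (path_prod r) w x = w (fun n => x (n + size r)%N).
  elim: r w x => [|b r IH] w x xP xr.
    rewrite /path_prod big_nil rho_one //; congr w; apply/funext => n.
    by rewrite addn0.
  rewrite /path_prod big_cons rhoM rhoa /= xP /= (xr 0%N) //= eqxx.
  rewrite IH ?infinite_path_shift //; last by move=> i ir; apply: (xr i.+1).
  by congr w; apply/funext => n; rewrite /ipath_shift addnS.
exists (fun x => rho x (fun=> 1) z); split=> [c x y||x].
- by rewrite rhol.
- exact: rho_one.
rewrite mulrBl mul1r (linB (rhol _)) rhoM.
rewrite -[LHS]/(rho x (fun=> 1) z - rho (path_prod q) (rho x (fun=> 1)) z).
rewrite rho_path // => [|i iq]; last by rewrite /z modn_small.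
rewrite (_ : (fun n => z (n + size q)%N) = z) ?subrr //.
by apply/funext => n; rewrite /z modnDr.
Qed.

Lemma closed_path_element : has_closed_path E ->
  exists (f : L) (rho : L -> L) (lam : L -> k^o),
    [/\ linear rho, forall x, rho (x * f) = x, linear lam, lam 1 = 1
      & forall x, lam (f * x) = 0].
Proof.
move=> [a [p [ap pa]]]; pose f : L := 1 - path_prod (a :: p).
have [lam [lamlin lam1 lamf]] := closed_path_functional ap pa.
have [||rho rholin rhoK] := @linear_retraction k L L (fun x => x * f).
- by move=> c x y; rewrite mulrDl scalerAl.
- move=> x /eqP; rewrite mulrBr mulr1 subr_eq0 => /eqP.
  exact: path_regular.
by exists f, rho, lam.
Qed.

End ClosedPath.

(** * Infinite tensor products *)

Section TensorMap.
Variables (k : fieldType) (A B : algType k) (g : A -> A) (h : B -> B).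
Hypotheses (glin : linear g) (hlin : linear h).

Definition tens_map (x : tens A B) : tens A B :=
  tens_lift (fun a b => tpure (g a) (h b)) x.

Fact tens_map_bilin : bilin (fun a b => tpure (g a) (h b)).
Proof.
split=> [b c a a'|a c b b'] /=; first by rewrite glin tpureDl tpureZl.
by rewrite hlin tpureDr tpureZr.
Qed.

Lemma tens_map_pure a b : tens_map (tpure a b) = tpure (g a) (h b).
Proof. exact/tens_lift_pure/bilin_map/tens_map_bilin. Qed.

Lemma tens_map_lin : linear tens_map.
Proof. exact/tens_lift_lin/tens_map_bilin. Qed.

End TensorMap.

Lemma tens_eq_lin (k : fieldType) (A B : algType k) (V : lmodType k)
    (g h : tens A B -> V) : linear g -> linear h ->
  (forall a b, g (tpure a b) = h (tpure a b)) -> g =1 h.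
Proof.
move=> glin hlin gh x; elim/tens_ind: x => [|x y IHx IHy|a b] //.
- by rewrite (lin0 glin) (lin0 hlin).
- by rewrite (linD glin) (linD hlin) IHx IHy.
Qed.

Section StageMap.
Variables (k : fieldType) (A : nat -> algType k).
Local Notation T := (inftens_stage A).

Fixpoint stage_map (g : forall j, A j -> A j) (N : nat) : T N -> T N :=
  match N return T N -> T N with
  | 0 => g 0%N
  | m.+1 => @tens_map k (T m) (A m.+1) (@stage_map g m) (g m.+1)
  end.

Fixpoint stage_pure (e : forall j, A j) (N : nat) : T N :=
  match N return T N with
  | 0 => e 0%N
  | m.+1 => @tpure k (T m) (A m.+1) (stage_pure e m) (e m.+1)
  end.

Lemma stage_map_lin g N : (forall j, linear (g j)) -> linear (@stage_map g N).
Proof.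
move=> glin; elim: N => [|N IH]; first exact: glin.
exact/tens_map_lin.
Qed.

Lemma stage_map_comp g h N : (forall j, linear (g j)) ->
  (forall j, linear (h j)) -> forall x,
  @stage_map g N (stage_map h x) = stage_map (fun j y => g j (h j y)) x.
Proof.
move=> glin hlin; have ghlin j : linear (fun y => g j (h j y)).
  by move=> c x y; rewrite hlin glin.
have gl n := @stage_map_lin g n glin; have hl n := @stage_map_lin h n hlin.
elim: N => [|N IH] // x; rewrite -[LHS]/((_ \o _) x).
apply: (@tens_eq_lin k (T N) (A N.+1) (T N.+1)).
- move=> c y z.
  exact: (etrans (congr1 _ (hl N.+1 c y z)) (gl N.+1 c _ _)).
- exact: (@stage_map_lin _ N.+1 ghlin).
move=> a b /=; rewrite !tens_map_pure //; last exact: stage_map_lin.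
by rewrite IH.
Qed.

Lemma stage_map_id g N : (forall j x, g j x = x) ->
  forall x, @stage_map g N x = x.
Proof.
move=> g1; have glin j : linear (g j) by move=> c x y; rewrite !g1.
elim: N => [|N IH] x; first exact: g1.
apply: (@tens_eq_lin k (T N) (A N.+1) (T N.+1) _ id) => //.
  exact: (@stage_map_lin _ N.+1 glin).
move=> a b /=; rewrite tens_map_pure // ?IH ?g1 //; exact: stage_map_lin.
Qed.

Lemma stage_map_eq0 g t N : (forall j, linear (g j)) -> (t <= N)%N ->
  (forall x, g t x = 0) -> forall x, @stage_map g N x = 0.
Proof.
move=> glin; elim: N => [|N IH] tN g0 x.
  by move: tN g0; rewrite leqn0 => /eqP -> g0; apply: g0.
have t0 (U B : algType k) (b : B) : tpure (0 : U) b = 0.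
  by rewrite -(scale0r (0 : U)) tpureZl scale0r.
have t0' (U B : algType k) (a : U) : tpure a (0 : B) = 0.
  by rewrite -(scale0r (0 : B)) tpureZr scale0r.
apply: (@tens_eq_lin k (T N) (A N.+1) (T N.+1) _ (fun=> 0)).
- exact: (@stage_map_lin _ N.+1 glin).
- by move=> c y z; rewrite scaler0 addr0.
move=> a b /=; rewrite tens_map_pure //; last exact: stage_map_lin.
move: tN; rewrite leq_eqVlt ltnS => /orP[/eqP tN|tN]; last by rewrite IH.
by subst t; rewrite g0.
Qed.

Lemma stage_map_next g N x : (forall j, linear (g j)) -> g N.+1 1 = 1 ->
  stage_map g (inftens_map A N x) = inftens_map A N (stage_map g x).
Proof.
move=> glin g1; rewrite -[LHS]/(tens_map _ _ (tpure x 1)).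
rewrite (tens_map_pure (@stage_map_lin g N glin) (glin N.+1)).
by rewrite g1.
Qed.

Lemma stage_pure_next e N : e N.+1 = 1 ->
  stage_pure e N.+1 = inftens_map A N (stage_pure e N).
Proof. by move=> /= ->. Qed.

Lemma stage_pure_mull e N x :
  stage_pure e N * x = stage_map (fun j y => e j * y) x.
Proof.
have elin j : linear (fun y : A j => e j * y).
  by move=> c y z; rewrite mulrDr scalerAr.
elim: N x => [|N IH] // x.
apply: (@tens_eq_lin k (T N) (A N.+1) (T N.+1) (fun x => stage_pure e N.+1 * x)).
- by move=> c y z; rewrite mulrDr scalerAr.
- exact: (@stage_map_lin _ N.+1 elin).
move=> a b /=; rewrite tens_map_pure //; last exact: stage_map_lin.
by rewrite -IH; apply: tpureM.
Qed.

Lemma stage_pure_mulr e N x :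
  x * stage_pure e N = stage_map (fun j y => y * e j) x.
Proof.
have elin j : linear (fun y : A j => y * e j).
  by move=> c y z; rewrite mulrDl scalerAl.
elim: N x => [|N IH] // x.
apply: (@tens_eq_lin k (T N) (A N.+1) (T N.+1) (fun x => x * stage_pure e N.+1)).
- by move=> c y z; rewrite mulrDl scalerAl.
- exact: (@stage_map_lin _ N.+1 elin).
move=> a b /=; rewrite tens_map_pure //; last exact: stage_map_lin.
by rewrite -IH; apply: tpureM.
Qed.

Lemma stage_pureM e e' N :
  stage_pure e N * stage_pure e' N = stage_pure (fun j => e j * e' j) N.
Proof. by elim: N => [|N IH] //=; rewrite -IH; apply: tpureM. Qed.

Lemma stage_map_ext g h N : (forall j x, g j x = h j x) ->
  forall x, @stage_map g N x = stage_map h x.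
Proof.
move=> gh x; have -> // : g = h.
by apply: functional_extensionality_dep => j; apply/funext/gh.
Qed.

Lemma stage_pure_ext e e' N : (forall j, e j = e' j) ->
  stage_pure e N = stage_pure e' N.
Proof. by move=> ee'; elim: N => [|N IH] //=; rewrite ?IH ee'. Qed.

End StageMap.

Section ColimitMap.
Variables (k : fieldType) (T : nat -> algType k).
Variable f : forall n, {lrmorphism T n -> T n.+1}.

(** Compatibility from stage t on is enough, because every element comes from
    such a stage.  For an operator which acts on the t-th tensor factor, earlier
    stages carry no information. *)
Lemma colim_map_ex (t : nat) (op : forall N, T N -> T N) :
  (forall N, linear (@op N)) ->
  (forall N x, (t <= N)%N -> op N.+1 (f N x) = f N (op N x)) ->
  exists2 O : seqcolim f -> seqcolim f, linear O &
    forall N x, (t <= N)%N -> O (incolim f x) = incolim f (op N x).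
Proof.
move=> oplin opf.
have op_trans N M x : (t <= N)%N -> (N <= M)%N ->
    op M (trans f M x) = trans f M (op N x).
  move=> tN; elim: M => [|M IH] NM.
    by move: NM tN x; rewrite leqn0 => /eqP -> _ x; rewrite !trans_id.
  move: NM; rewrite leq_eqVlt ltnS => /orP[/eqP NM|NM].
    by subst N; rewrite !trans_id.
  by rewrite !transS // opf ?IH // (leq_trans tN).
have rep (s : seqcolim f) : exists p : {N : nat & T N},
    (t <= projT1 p)%N /\ s = incolim f (projT2 p).
  have [N NP] := incolim_ex_ge s; have [y ->] := NP (maxn t N) (leq_maxr _ _).
  by exists (existT _ (maxn t N) y); split=> //; apply: leq_maxl.
have [p pP] := choice rep.
pose O s := incolim f (op _ (projT2 (p s))).
have OE N x : (t <= N)%N -> O (incolim f x) = incolim f (op N x).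
  move=> tN; have [tp /incolim_eq[M [NM pM e]]] := pP (incolim f x).
  apply/incolim_eq; exists M; split=> //.
  by rewrite -!op_trans // e.
exists O => // c x y.
have [[N x'] [/= tN xE]] := rep x; have [M MP] := incolim_ex_ge y.
pose m := maxn N M.
have [y' ->] := MP m (leq_maxr _ _).
have mt : (t <= m)%N by rewrite (leq_trans tN) ?leq_maxl.
rewrite xE -(@incolim_trans _ _ f N m) ?leq_maxl //.
by rewrite -incolimZ -incolimD !OE // oplin incolimD incolimZ.
Qed.

End ColimitMap.

Section InfiniteTensor.
Variables (k : fieldType) (A : nat -> algType k).
Local Notation S := (inftens A).
Local Notation inc x := (incolim (inftens_map A) x).
Variables (f : forall j, A j) (rho : forall j, A j -> A j).
Variable lam : forall j, A j -> k^o.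
Hypothesis rholin : forall j, linear (@rho j).
Hypothesis lamlin : forall j, linear (@lam j).
Hypothesis lam1 : forall j, lam (1 : A j) = 1.

Definition at_index (t j : nat) : A j := if j == t then f j else 1.

Definition tens_coord (t : nat) : S := inc (stage_pure (at_index t) t).

Lemma tens_coordE t N : (t <= N)%N ->
  tens_coord t = inc (stage_pure (at_index t) N).
Proof.
elim: N => [|N IH]; first by rewrite leqn0 => /eqP ->.
rewrite leq_eqVlt ltnS => /orP[/eqP <-//|tN].
rewrite IH // stage_pure_next ?incolim_f //.
by rewrite /at_index gtn_eqF.
Qed.

Lemma inftens_stageP t (x : S) :
  exists N (y : inftens_stage A N), (t <= N)%N /\ x = inc y.
Proof.
have [N NP] := incolim_ex_ge x; have [y ->] := NP (maxn t N) (leq_maxr _ _).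
by exists (maxn t N), y; rewrite leq_maxl.
Qed.

Lemma tens_coordC t l :
  tens_coord t * tens_coord l = tens_coord l * tens_coord t.
Proof.
rewrite (@tens_coordE t (maxn t l)) ?leq_maxl //.
rewrite (@tens_coordE l (maxn t l)) ?leq_maxr //.
rewrite -[LHS]incolimM -[RHS]incolimM !stage_pureM; congr incolim.
apply: stage_pure_ext => j; rewrite /at_index.
by case: eqP; case: eqP; rewrite ?mulr1 ?mul1r.
Qed.

(** The operator rho, acting on the t-th factor and as the identity elsewhere,
    commutes with what happens in the other factors. *)
Lemma tens_coord_retraction t : (forall x, rho (x * f t) = x) ->
  exists R : S -> S, [/\ linear R, forall x, R (x * tens_coord t) = x
    & forall l x, l != t -> R (x * tens_coord l) = R x * tens_coord l].
Proof.
move=> rhoK; pose g j (x : A j) : A j := if j == t then rho x else x.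
have glin j : linear (g j).
  by move=> c x y; rewrite /g; case: (j == t); rewrite ?rholin.
have [|N x tN|R Rlin RE] := @colim_map_ex k _ (inftens_map A) t (stage_map g).
- by move=> N; apply: stage_map_lin.
- by apply: stage_map_next => //; rewrite /g gtn_eqF.
have alin l j : linear (fun y => y * at_index l j).
  by move=> c y z; rewrite mulrDl scalerAl.
exists R; split=> // [x|l x lt].
  have [N [y [tN ->]]] := inftens_stageP t x.
  rewrite (tens_coordE tN) -[X in R X]incolimM RE //; congr incolim.
  rewrite stage_pure_mulr (stage_map_comp glin (alin t)).
  apply: stage_map_id => j z.
  rewrite /g /at_index; case: eqP => [jt|_]; last by rewrite mulr1.
  by subst j.
have [N [y [mN ->]]] := inftens_stageP (maxn t l) x.
have tN : (t <= N)%N by rewrite (leq_trans _ mN) ?leq_maxl.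
have lN : (l <= N)%N by rewrite (leq_trans _ mN) ?leq_maxr.
rewrite (tens_coordE lN) -[X in R X]incolimM !RE // -[RHS]incolimM.
congr incolim; rewrite !stage_pure_mulr (stage_map_comp glin (alin l)).
rewrite (stage_map_comp (alin l) glin).
apply: stage_map_ext => j z; rewrite /g /at_index.
case: (eqVneq j t) => [jt|_] //; rewrite jt in z *.
by rewrite eq_sym (negPf lt) !mulr1.
Qed.

(** e is the tensor product of the linear forms lam, followed by the inclusion
    of the ground field.  Composed with left multiplication by the element of
    factor t, its component at t is zero. *)
Lemma tens_coord_augmentation (D : set nat) :
  (forall t, D t -> forall x, lam (f t * x) = 0) ->
  exists e : S -> S, [/\ linear e, e 1 = 1
    & forall t x, D t -> e (tens_coord t * x) = 0].
Proof.
move=> lamf; pose g j (x : A j) : A j := (lam x : k) *: 1.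
have glin j : linear (g j).
  by move=> c x y; rewrite /g lamlin scalerDl scalerA.
have g1 j : g j 1 = 1 by rewrite /g lam1 scale1r.
have [|N x _|e elin eE] := @colim_map_ex k _ (inftens_map A) 0 (stage_map g).
- by move=> N; apply: stage_map_lin.
- by apply: stage_map_next => //; apply: g1.
exists e; split=> // [|t x Dt].
  rewrite -[1 in LHS]/(colim_one (inftens_map A)) (colim_oneE _ 0) eE //.
  rewrite -[RHS]/(colim_one (inftens_map A)) (colim_oneE _ 0).
  by congr incolim; apply: g1.
have [N [y [tN ->]]] := inftens_stageP t x.
rewrite (tens_coordE tN) -[X in e X]incolimM eE // stage_pure_mull.
have alin j : linear (fun y => at_index t j * y).
  by move=> c u v; rewrite mulrDr scalerAr.
rewrite (stage_map_comp glin alin) (@stage_map_eq0 _ _ _ t) //.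
- by rewrite -[RHS]/(colim_zero (inftens_map A)) (colim_zeroE _ N).
- by move=> j c u v; rewrite alin glin.
by move=> u; rewrite /g /at_index eqxx lamf // scale0r.
Qed.

End InfiniteTensor.

Lemma infinite_increasing (D : set nat) : infinite_set D ->
  exists2 t : nat -> nat,
    forall i, D (t i) & forall i j, (i < j)%N -> (t i < t j)%N.
Proof.
move=> Dinf; have next N : exists m, (N <= m)%N /\ D m.
  apply: contrapT => none; case: Dinf.
  apply: (sub_finite_set _ (finite_II N)) => m Dm /=.
  by rewrite ltnNge; apply/negP => Nm; apply: none; exists m.
have [g gP] := choice next.
pose t := fix t i := if i is j.+1 then g (t j).+1 else g 0%N.
exists t => [[|i]|]; first exact: (gP 0%N).2.
  exact: (gP (t i).+1).2.
by apply: (homo_ltn ltn_trans) => i; apply: (gP (t i).+1).1.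
Qed.

(** * The theorem *)

Local Open Scope classical_set_scope.

Theorem theorem5p5 (k : fieldType)
    (n : nat) (E : 'I_n.+1 -> nequiver) (F : nat -> nequiver)
    (hF : infinite_set [set i : nat | has_closed_path (F i)]) :
  ~ morita_equivalent
      (fintens (fun i : 'I_n.+1 => leavitt k (E i)))
      (inftens (fun i : nat => leavitt k (F i))).
Proof.
pose A j : algType k := leavitt k (F j).
move=> morita.
pose good j (d : A j * (A j -> A j) * (A j -> k^o)) :=
  [/\ linear d.1.2, linear d.2, d.2 1 = 1 &
    has_closed_path (F j) ->
      (forall x, d.1.2 (x * d.1.1) = x) /\ (forall x, d.2 (d.1.1 * x) = 0)].
have ex j : exists d, @good j d.
  have [closed|open] := pselect (has_closed_path (F j)).
    have [f [rho [lam [? ? ? ? ?]]]] := closed_path_element k closed.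
    by exists (f, rho, lam).
  have [lam lamlin lam1] := linear_form_ex (oner_neq0 (A j)).
  by exists (0, id, lam).
pose d j := projT1 (cid (ex j)).
have dP j : good j (d j) := projT2 (cid (ex j)).
pose f j := (d j).1.1; pose rho j := (d j).1.2; pose lam j := (d j).2.
have rholin j : linear (rho j) by case: (dP j).
have lamlin j : linear (lam j) by case: (dP j).
have lam1 j : lam j 1 = 1 by case: (dP j).
have [t tF tlt] := infinite_increasing hF.
have rhoK i x : rho (t i) (x * f (t i)) = x.
  by have [_ _ _ /(_ (tF i))[rK _]] := dP (t i); apply: rK.
have lamf j : has_closed_path (F j) -> forall x, lam j (f j * x) = 0.
  by have [_ _ _ closed] := dP j; move=> /closed[_ lK] x; apply: lK.
have [R RP] := choice (fun i => tens_coord_retraction rholin (rhoK i)).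
have [e [elin e1 e0]] := tens_coord_augmentation lamlin lam1 lamf.
have [||||c cE] := @morita_koszul_splits k _ _ n.+3
    (fun i => tens_coord f (t i)) R morita (@leavitt_tensor_koszul_splits k n E).
- by move=> i j; apply: tens_coordC.
- by move=> i; case: (RP i).
- by move=> i x; case: (RP i) => _ ->.
- move=> i l x li; have [_ _ Rl] := RP i; apply: Rl.
  by rewrite ltn_eqF // tlt.
have := oner_neq0 (inftens A); rewrite -e1 -cE (lin_sum elin).
by rewrite big1 ?eqxx // => i _; apply: e0; apply: tF.
Qed.
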